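(* NLimInf is reducible to PosLimInf, and PosLimInf is reducible to AsLimInf; moreover both inclusions are strict: PosLimInf is not reducible to NLimInf, and AsLimInf is not reducible to PosLimInf.
   Context: A probabilistic weighted automaton over a finite alphabet $\Sigma$ is a tuple $A=(Q,\rho_I,\Sigma,\delta,\gamma)$ where $Q$ is a finite set of states, $\rho_I$ is a probability distribution on $Q$, $\delta:Q\times\Sigma\to\mathcal D(Q)$ assigns to each state and letter a probability distribution on $Q$, and $\gamma:Q\times\Sigma\times Q\to\mathbb Q$ is a weight function. A run over an infinite word $w=\sigma_1\sigma_2\dots$ is a sequence $r=q_0\sigma_1q_1\sigma_2\dots$ with $\rho_I(q_0)>0$ and $\delta(q_i,\sigma_{i+1})(q_{i+1})>0$ for all $i$; its weight sequence is $\gamma(r)=v_0v_1\dots$ with $v_i=\gamma(q_i,\sigma_{i+1},q_{i+1})$. For each $w$, the probabilities of finite run prefixes $\rho_I(q_0)\prod_{i=1}^k\delta(q_{i-1},\sigma_i)(q_i)$ induce a probability measure $\mathbb P^A$ on runs over $w$. For a value function $\mathrm{Val}$, the positive semantics is $L^{>0}_A(w)=\sup\{\eta\mid \mathbb P^A(\{r:\mathrm{Val}(\gamma(r))\ge\eta\})>0\}$ and the almost-sure semantics is $L^{=1}_A(w)=\sup\{\eta\mid \mathbb P^A(\{r:\mathrm{Val}(\gamma(r))\ge\eta\})=1\}$. Ignoring probabilities (initial states are those with $\rho_I(q)>0$, transitions those with $\delta(q,\sigma)(q')>0$) gives a nondeterministic automaton with language $L^{\max}_A(w)=\sup\{\mathrm{Val}(\gamma(r))\mid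 r\text{ run over }w\}$. Here $\mathsf{LimInf}(v)=\liminf_{n\to\infty}v_n$. NLimInf, PosLimInf, AsLimInf denote the classes of $\mathsf{LimInf}$-automata under nondeterministic, positive, and almost-sure semantics. A class $\mathcal C$ is reducible to $\mathcal C'$ if for every $A\in\mathcal C$ there is $A'\in\mathcal C'$ over the same alphabet defining the same quantitative language $\Sigma^\omega\to\mathbb R$. *)

(* Defs.v *)
From HB Require Import structures.
From mathcomp Require Import all_boot all_order all_algebra.
From mathcomp Require Import all_classical all_reals.
From mathcomp Require Import ereal sequences measure.
Set Implicit Arguments.
Unset Strict Implicit.
Unset Printing Implicit Defensive.
Import Order.TTheory GRing.Theory Num.Theory.
Local Open Scope classical_set_scope.
Local Open Scope ring_scope.

Record pwa (R : realType) (Sigma : finType) := PWA {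
  state : finType;
  init : state -> R;
  trans : state -> Sigma -> state -> R;
  weight : state -> Sigma -> state -> rat;
  init_ge0 : forall q, 0 <= init q;
  init_sum1 : \sum_(q : state) init q = 1;
  trans_ge0 : forall q s q', 0 <= trans q s q';
  trans_sum1 : forall q s, \sum_(q' : state) trans q s q' = 1 }.

Section Semantics.
Variables (R : realType) (Sigma : finType) (A : pwa R Sigma).
Implicit Types (w : nat -> Sigma) (r : nat -> state A).

(* r = q0 q1 q2 ... is a run over w = sigma_1 sigma_2 ... (here w i is
   the letter sigma_{i+1}) *)
Definition is_run w r : Prop :=
  0 < init (r 0%N) /\ forall i, 0 < trans (r i) (w i) (r i.+1).

Definition weight_seq w r : (\bar R)^nat :=
  fun i => (ratr (weight (r i) (w i) (r i.+1)))%:E.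

Definition LimInf (v : (\bar R)^nat) : \bar R := limn_einf v.

Definition cyl n r : set (nat -> state A) :=
  [set r' | forall i, (i <= n)%N -> r' i = r i].

Definition prefix_prob w n r : R :=
  init (r 0%N) * \prod_(i < n) trans (r i) (w i) (r i.+1).

Definition cylinders : set (set (nat -> state A)) :=
  [set C | exists n r, C = cyl n r].

(* P is the probability measure P^A on state sequences over w: a
   countably additive probability measure on the sigma-algebra generated
   by the cylinders, giving each cylinder the probability of its prefix
   (by Caratheodory/Ionescu-Tulcea it exists and is unique). *)
Definition is_run_measure w (P : set (nat -> state A) -> \bar R) : Prop :=
  [/\ P set0 = 0%E,
      (forall X, <<s cylinders >> X -> (0 <= P X)%E),
      (forall F : (set (nat -> state A))^nat,
         (forall k, <<s cylinders >> (F k)) -> trivIset setT F ->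
         (fun n => (\sum_(k < n) P (F k))%E) @ \oo --> P (\bigcup_k F k)),
      P setT = 1%E &
      (forall n r, P (cyl n r) = (prefix_prob w n r)%:E)].

Definition event w (eta : R) : set (nat -> state A) :=
  [set r | is_run w r /\ (eta%:E <= LimInf (weight_seq w r))%E].

Definition LPos w : \bar R :=
  ereal_sup [set x | exists eta : R, x = eta%:E /\
    forall P, is_run_measure w P -> (0 < P (event w eta))%E].

Definition LAs w : \bar R :=
  ereal_sup [set x | exists eta : R, x = eta%:E /\
    forall P, is_run_measure w P -> P (event w eta) = 1%E].

Definition LMax w : \bar R :=
  ereal_sup [set x | exists r, is_run w r /\ x = LimInf (weight_seq w r)].

End Semantics.

Definition semantics (R : realType) :=
  forall Sigma : finType, pwa R Sigma -> (nat -> Sigma) -> \bar R.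

Definition NLimInf (R : realType) : semantics R := fun Sigma A => @LMax R Sigma A.
Definition PosLimInf (R : realType) : semantics R := fun Sigma A => @LPos R Sigma A.
Definition AsLimInf (R : realType) : semantics R := fun Sigma A => @LAs R Sigma A.

Definition reducible (R : realType) (C C' : semantics R) : Prop :=
  forall (Sigma : finType) (A : pwa R Sigma),
    exists B : pwa R Sigma, forall w : nat -> Sigma, C Sigma A w = C' Sigma B w.

(* Main.v *)
Require Import Defs.
From HB Require Import structures.
From mathcomp Require Import all_boot all_order all_algebra.
From mathcomp Require Import all_classical all_reals.
From mathcomp Require Import ereal sequences measure.
From mathcomp Require Import topology normedtype lebesgue_measure.
From mathcomp Require Import zify ring lra.
Set Implicit Arguments.
Unset Strict Implicit.
Unset Printing Implicit Defensive.
Import Order.TTheory GRing.Theory Num.Theory.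
Import numFieldNormedType.Exports.
Local Open Scope classical_set_scope.
Local Open Scope ring_scope.

(* Fix a word and a threshold eta, and let [stay n k] be the probability that
   the k steps following time n all have weight at least eta. As the weights
   take finitely many values, a run has value at least eta iff its weights are
   eventually at least eta, and by continuity of the run measure the three
   semantics depend on [stay] only:
   - some run has value at least eta iff, for some n, [stay n k] > 0 for all k
     (by Koenig's lemma);
   - such runs have positive probability iff, for some n, [stay n] is bounded
     away from 0;
   - such runs have probability 1 iff, for every e > 0, [stay n] >= 1 - e for
     some n.

   From nondeterministic to positive: a breakpoint construction gives a pwa with
   deterministic transitions, on which the first two conditions coincide.
   From positive to almost-sure: simulate a run, and restart it from a uniformly
   chosen state of the current support whenever its weight is too small. If the
   given pwa has positive probability, a late restart succeeds with
   probability bounded below, so that almost surely restarts stop; otherwise no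
   restart ever succeeds. A random initial level, with weights chosen so that
   the failing levels give the minimum, handles all the weights at once.

   Strictness: a positive pwa recognizes the words a^k1 b a^k2 b ... such that
   the product of the 1 - 2^-ki is positive, and this set contains words with
   infinitely many b but no ultimately periodic one, which pumping excludes for
   a nondeterministic pwa. An almost-sure pwa recognizes the words with
   infinitely many b, which by the second condition above cannot be done by a
   positive one, as they do not form an F_sigma set. *)

(** * Values and thresholds *)

Section Threshold.
Context {R : realType} {Sigma : finType} (A : pwa R Sigma) (w : nat -> Sigma).
Implicit Types (r : nat -> state A) (eta : R).

Definition good eta (i : nat) (q q' : state A) : bool :=
  eta <= ratr (weight q (w i) q').

(** There are finitely many edges: if weights below [eta] recur forever, the largest weight below
    [eta] bounds every tail infimum, hence the limit inferior. *)
Lemma LimInf_geP eta r :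
  (eta%:E <= LimInf (weight_seq w r))%E <->
  exists n, forall i, (n <= i)%N -> good eta i (r i) (r i.+1).
Proof.
rewrite /LimInf limn_einf_lim.
have -> : limn (einfs (weight_seq w r)) = ereal_sup (range (einfs (weight_seq w r))).
  by apply/cvg_lim => //; exact: cvg_einfs_sup.
split; last first.
  move=> [n gn]; apply: (@le_trans _ _ (einfs (weight_seq w r) n)); last first.
    by apply: ereal_sup_ubound; exists n.
  by apply: le_ereal_inf_tmp => _ [i /= ni] <-; rewrite lee_fin; apply: gn.
move=> le_eta; apply: contrapT => /forallNP bad.
pose W (x : state A * Sigma * state A) : R := ratr (weight x.1.1 x.1.2 x.2).
have bad_inf n : exists2 i, (n <= i)%N & W (r i, w i, r i.+1) < eta.
  have /existsNP[i /not_implyP[ni /negP]] := bad n.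
  by rewrite -ltNge => ?; exists i.
have [i0 _ bad0] := bad_inf 0%N.
pose x0 := (r i0, w i0, r i0.+1).
case: (@Order.TotalTheory.arg_maxP _ _ _ x0 [pred x | W x < eta] W bad0) => x /= Wx maxx.
suff : (eta%:E <= (W x)%:E)%E by rewrite lee_fin leNgt Wx.
apply: (le_trans le_eta); apply: ge_ereal_sup => _ [n _ <-].
have [i ni Wi] := bad_inf n.
apply: (@le_trans _ _ (weight_seq w r i)); first by apply: ereal_inf_lbound; exists i.
exact: (maxx (r i, w i, r i.+1)).
Qed.

End Threshold.
Arguments good {R Sigma} A w eta i q q'.

Section Suprema.
Context {R : realType}.
Implicit Types (p q : R -> Prop).

(** Each semantics is such a supremum, so automata can be compared at each threshold separately. *)
Definition level_sup p : \bar R :=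
  ereal_sup [set x | exists eta : R, x = eta%:E /\ p eta].

Lemma level_sup_ext p q : (forall eta, p eta <-> q eta) -> level_sup p = level_sup q.
Proof. by move=> pq; congr level_sup; apply/funext => eta; apply/propext. Qed.

Lemma level_sup_ge p eta : p eta -> (eta%:E <= level_sup p)%E.
Proof. by move=> ?; apply: ereal_sup_ubound; exists eta. Qed.

(** The supremum need not be attained, so the condition is recovered strictly below it. Hence the
    strictness proofs lower the threshold from 1 to [2^-1] and then to [4^-1]. *)
Lemma level_sup_gt p (x : R) : (forall eta eta', eta <= eta' -> p eta' -> p eta) ->
  (x%:E < level_sup p)%E -> p x.
Proof.
move=> pW /ereal_sup_gt[_ [eta [-> peta]]]; rewrite lte_fin => /ltW xeta.
exact: pW peta.
Qed.

Lemma LMax_level_sup (Sigma : finType) (A : pwa R Sigma) w :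
  LMax A w = level_sup (fun eta => exists r, event (A := A) w eta r).
Proof.
apply/eqP; rewrite eq_le; apply/andP; split.
  apply: ge_ereal_sup => _ [r [run_r ->]].
  case E: (LimInf _) => [x| |]; last by rewrite leNye.
    by apply: level_sup_ge; exists r; split; rewrite // E.
  rewrite leye_eq; apply/eqP/eq_infty => x.
  by apply: level_sup_ge; exists r; split; rewrite // E leey.
apply: ge_ereal_sup => _ [eta [-> [r [run_r le_eta]]]].
by apply: (le_trans le_eta); apply: ereal_sup_ubound; exists r.
Qed.

End Suprema.

(** * Survival probabilities *)

Section Pigeonhole.
Context {I : finType}.

(** If each [i] failed at some [m i], all would fail at the maximum of the [m i]. This is the
    pigeonhole step of Koenig's lemma. *)
Lemma finite_persistent (p : I -> nat -> Prop) :
  (forall i k l, (k <= l)%N -> p i l -> p i k) -> (forall k, exists i, p i k) ->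
  exists i, forall k, p i k.
Proof.
move=> pW ex_p; apply: contrapT => /forallNP no_p.
have /choice[m mP] i : exists k, ~ p i k by have /existsNP := no_p i.
have [i] := ex_p (\max_i m i).
by move/(pW i (m i) _ (leq_bigmax i)) => /mP.
Qed.

Lemma sum_gt0_ex {R : realDomainType} (F : I -> R) :
  0 < \sum_i F i -> exists i, 0 < F i.
Proof.
move=> F0; apply: contrapT => /forallNP noF; move: F0; rewrite ltNge sumr_le0 // => i _.
by rewrite leNgt; apply/negP/noF.
Qed.

End Pigeonhole.

Section Survival.
Context {R : realType} {Sigma : finType} (A : pwa R Sigma) (w : nat -> Sigma).
Implicit Types (G : nat -> state A -> state A -> bool) (q : state A).

(** [G] depends on time so that it can encode a constraint imposed only from some time on, as in
    [stay_init]. *)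
Fixpoint surv G (i k : nat) q : R :=
  if k is k'.+1 then
    \sum_q' trans q (w i) q' * (G i q q')%:R * surv G i.+1 k' q'
  else 1.

Fixpoint law (n : nat) q : R :=
  if n is n'.+1 then \sum_q' law n' q' * trans q' (w n') q else init q.

Lemma lawS n q : law n.+1 q = \sum_q' law n q' * trans q' (w n) q.
Proof. by []. Qed.

Definition stay G n k : R := \sum_q law n q * surv G n k q.

Lemma surv_ge0 G i k q : 0 <= surv G i k q.
Proof.
elim: k i q => [|k IH] i q //=.
by apply: sumr_ge0 => q' _; rewrite !mulr_ge0 ?trans_ge0.
Qed.

Lemma surv_le1 G i k q : surv G i k q <= 1.
Proof.
elim: k i q => [|k IH] i q //=.
rewrite -[leRHS](trans_sum1 q (w i)); apply: ler_sum => q' _.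
rewrite -mulrA ler_piMr ?trans_ge0 //.
by rewrite mulr_ile1 ?surv_ge0 ?IH ?ler0n ?lern1 ?leq_b1.
Qed.

Lemma law_ge0 n q : 0 <= law n q.
Proof.
elim: n q => [|n IH] q /=; first exact: init_ge0.
by apply: sumr_ge0 => q' _; rewrite mulr_ge0 ?trans_ge0.
Qed.

Lemma law_sum1 n : \sum_q law n q = 1.
Proof.
elim: n => [|n IH] /=; first exact: init_sum1.
rewrite exchange_big /= -IH; apply: eq_bigr => q _.
by rewrite -mulr_sumr trans_sum1 mulr1.
Qed.

Lemma surv_antitone G i k l q : (k <= l)%N -> surv G i l q <= surv G i k q.
Proof.
elim: k l i q => [|k IH] [|l] i q //; first by rewrite surv_le1.
rewrite ltnS => kl /=; apply: ler_sum => q' _.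
by apply: ler_wpM2l; [rewrite mulr_ge0 ?trans_ge0|exact: IH].
Qed.

Lemma surv_le G G' i k q : (forall j q q', (i <= j)%N -> G j q q' -> G' j q q') ->
  surv G i k q <= surv G' i k q.
Proof.
move=> GG'; elim: k i GG' q => [|k IH] i GG' q //=; apply: ler_sum => q' _.
apply: ler_pM; rewrite ?mulr_ge0 ?trans_ge0 ?surv_ge0 //.
  apply: ler_wpM2l; rewrite ?trans_ge0 // ler_nat.
  by case: (boolP (G i q q')) => // /GG' ->.
by apply: IH => j ? ? /ltnW; exact: GG'.
Qed.

Lemma surv_ext G G' i k q : (forall j, (i <= j)%N -> G j =2 G' j) ->
  surv G i k q = surv G' i k q.
Proof.
move=> GG'; apply/eqP; rewrite eq_le.
by apply/andP; split; apply: surv_le => j ? ? ij; rewrite GG'.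
Qed.

(** The masked constraint leaves the first [n] steps free, so the backward recursion [surv] from
    time 0 meets the forward recursion [law] at [n]. *)
Lemma stay_init G n k :
  \sum_q init q * surv (fun i q q' => (n <= i)%N ==> G i q q') 0 (n + k) q = stay G n k.
Proof.
set G' := (X in surv X).
(* The two recursions meet at an intermediate time [i]; induction on its distance [d] to [n]. *)
suff H d i : (i + d)%N = n -> \sum_q law i q * surv G' i (d + k) q = stay G n k.
  by rewrite -(H n 0%N).
elim: d i => [|d IH] i; rewrite ?addn0 ?addnS => in_eq.
  rewrite in_eq; apply: eq_bigr => q _; congr (_ * _).
  by apply: surv_ext => j nj q1 q2; rewrite /G' nj.
rewrite addSn /= -(IH i.+1) //=.
under eq_bigr do rewrite mulr_sumr.
rewrite exchange_big /=; apply: eq_bigr => q _.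
rewrite mulr_suml; apply: eq_bigr => q' _.
by rewrite /G' -in_eq leqNgt ltnS leq_addr /= mulr1 mulrA.
Qed.

Lemma stay_ge0 G n k : 0 <= stay G n k.
Proof. by apply: sumr_ge0 => q _; rewrite mulr_ge0 ?law_ge0 ?surv_ge0. Qed.

Lemma stay_le1 G n k : stay G n k <= 1.
Proof.
rewrite -[leRHS](law_sum1 n); apply: ler_sum => q _.
by rewrite ler_piMr ?law_ge0 ?surv_le1.
Qed.

Lemma stayS G n k : stay G n k.+1 <= stay G n.+1 k.
Proof.
rewrite /stay /=; under eq_bigr do rewrite mulr_sumr.
rewrite exchange_big /=; apply: ler_sum => q _.
rewrite mulr_suml; apply: ler_sum => q' _.
rewrite mulrA; apply: ler_wpM2r; rewrite ?surv_ge0 // ler_wpM2l ?law_ge0 //.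
by rewrite ler_piMr ?trans_ge0 // lern1 leq_b1.
Qed.

Lemma stay_shift G n m k : (n <= m)%N -> stay G n (m - n + k) <= stay G m k.
Proof.
move=> /subnKC nm; rewrite -[X in _ <= stay G X _]nm.
elim: (m - n)%N k => [|d IH] k'; first by rewrite addn0.
by rewrite addSnnS [(n + _)%N]addnS; apply: le_trans (IH _) _; exact: stayS.
Qed.

End Survival.
Arguments surv {R Sigma} A w G i k q.
Arguments law {R Sigma} A w n q.
Arguments stay {R Sigma} A w G n k.

(** * The run measure *)

(* The generated sigma-algebra structure of the library asks for a pointed
   carrier; the extra argument supplies the point. *)
Definition paths {R : realType} {Sigma : finType} {A : pwa R Sigma} (q0 : state A)
  : Type := nat -> state A.
HB.instance Definition _ {R : realType} {Sigma : finType} {A : pwa R Sigma}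
  (q0 : state A) := Choice.copy (paths q0) (nat -> state A).
HB.instance Definition _ {R : realType} {Sigma : finType} {A : pwa R Sigma}
  (q0 : state A) := isPointed.Build (paths q0) (fun=> q0).

Section RunMeasure.
Context {R : realType} {Sigma : finType} (A : pwa R Sigma) (w : nat -> Sigma).
Variables (q0 : state A) (P : set (nat -> state A) -> \bar R).
Hypothesis PP : is_run_measure w P.
Implicit Types (r : nat -> state A) (G : nat -> state A -> state A -> bool).

Let Omega := g_sigma_algebraType (@cylinders R Sigma A : set (set (paths q0))).

(** Nothing is known of [P] outside the sigma-algebra; the value 0 there makes the function
    nonnegative on all sets. *)
Definition run_measure (X : set Omega) : \bar R :=
  if `[< measurable X >] then P X else 0%E.

Lemma run_measureE (X : set Omega) : measurable X -> run_measure X = P X.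
Proof. by move=> mX; rewrite /run_measure asboolT. Qed.

Let mu0 : run_measure set0 = 0%E.
Proof. by have [P0 _ _ _ _] := PP; rewrite run_measureE. Qed.

Let mu_ge0 X : (0 <= run_measure X)%E.
Proof.
have [_ P_ge0 _ _ _] := PP; rewrite /run_measure.
by case: asboolP => // /P_ge0.
Qed.

Let mu_sigma : semi_sigma_additive run_measure.
Proof.
have [_ _ Psigma _ _] := PP => F mF tF mUF.
rewrite run_measureE //.
have sumE n : (\sum_(0 <= i < n) run_measure (F i) = \sum_(i < n) P (F i))%E.
  by rewrite big_mkord; apply: eq_bigr => i _; rewrite run_measureE.
by under eq_fun do rewrite sumE; exact: Psigma.
Qed.

HB.instance Definition _ := isMeasure.Build _ _ _ run_measure mu0 mu_ge0 mu_sigma.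

Lemma measurable_cyl n r : measurable (cyl n r : set Omega).
Proof. by apply: sub_sigma_algebra; exists n, r. Qed.

Definition seg G n k : set (nat -> state A) := [set r | forall i, (n <= i < n + k)%N ->
  0 < trans (r i) (w i) (r i.+1) /\ G i (r i) (r i.+1)].

Let upd r n (q : state A) i := if i == n then q else r i.

Lemma cyl_segS G n k r : cyl n r `&` seg G n k.+1 =
  \bigcup_q (if (0 < trans (r n) (w n) q) && G n (r n) q
    then cyl n.+1 (upd r n.+1 q) `&` seg G n.+1 k else set0).
Proof.
rewrite seteqP; split => r'.
  move=> [rr' sr]; exists (r' n.+1) => //.
  have [] := sr n; first by rewrite leqnn addnS ltnS leq_addr.
  rewrite (rr' n) // => -> -> /=; split.
    move=> i; rewrite leq_eqVlt /upd ltnS => /orP[/eqP ->|le_in]; first by rewrite eqxx.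
    by rewrite ltn_eqF ?ltnS // rr'.
  by move=> i ni; apply: sr; lia.
move=> [q _]; case: ifP => // /andP[tq Gq] [rr' sr]; split.
  by move=> i le_in; rewrite rr' ?(leq_trans le_in) // /upd ltn_eqF ?ltnS.
move=> i /andP[]; rewrite leq_eqVlt => /orP[/eqP <- _|ni ink].
  by rewrite (rr' n) // (rr' n.+1) // /upd eqxx ltn_eqF.
by apply: sr; lia.
Qed.

Lemma mu_bigcup_fin (I : finType) (F : I -> set Omega) : (forall i, measurable (F i)) ->
  trivIset setT F -> run_measure (\bigcup_i F i) = (\sum_i run_measure (F i))%E.
Proof.
move=> mF tF; rewrite measure_fin_bigcup //; last exact: finite_finset.
have -> : [set: I] = [set` index_enum I].
  by apply/seteqP; split => x //= _; rewrite mem_index_enum.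
by rewrite -fsbig_seq ?index_enum_uniq.
Qed.

(** The event splits disjointly according to the state at time [n.+1], which matches the sum in the
    recursion of [surv]. *)
Lemma cyl_seg_measure G n k r :
  measurable (cyl n r `&` seg G n k : set Omega) /\
  run_measure (cyl n r `&` seg G n k) = (prefix_prob w n r * surv A w G n k (r n))%:E.
Proof.
have [_ _ _ _ Pcyl] := PP.
elim: k n r => [|k IH] n r.
  have -> : seg G n 0 = setT.
    by rewrite -subTset => r' _ i; rewrite addn0 ltnNge => /andP[->].
  rewrite setIT mulr1; split; first exact: measurable_cyl.
  by rewrite run_measureE ?Pcyl //; exact: measurable_cyl.
rewrite cyl_segS; set F := fun q => _.
have mF q : measurable (F q : set Omega).
  by rewrite /F; case: ifP => // _; exact: (IH _ _).1.
split.
  by apply: fin_bigcup_measurable => [|q _]; [exact: finite_finset|exact: mF].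
rewrite mu_bigcup_fin //; last first.
  move=> q q' _ _ [r' []]; rewrite /F; do 2 (case: ifP => // _).
  by move=> [+ _] [+ _] => /(_ n.+1 (leqnn _)) + /(_ n.+1 (leqnn _)); rewrite /upd eqxx => -> .
rewrite /= mulr_sumr -sumEFin; apply: eq_bigr => q _; rewrite /F.
have [tq|] := ltP 0 (trans (r n) (w n) q); last first.
  move=> tq; have -> : trans (r n) (w n) q = 0 by apply/le_anti; rewrite tq trans_ge0.
  by rewrite /= measure0 !mul0r mulr0.
case: (G n (r n) q) => /=; last by rewrite measure0 mulr0 mul0r mulr0.
rewrite (IH _ _).2 mulr1 /upd eqxx mulrA; congr (_ * _)%:E.
rewrite /prefix_prob big_ord_recr /= eqxx ltn_eqF // mulrA; congr (_ * _ * _).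
by apply: eq_bigr => i _; rewrite !ltn_eqF // ?ltnS; case: i => // i /= /ltnW.
Qed.

Definition init_seg G n k : set (nat -> state A) := [set r | 0 < init (r 0%N) /\
  forall i, (i < n + k)%N ->
    0 < trans (r i) (w i) (r i.+1) /\ ((n <= i)%N -> G i (r i) (r i.+1))].

Lemma init_seg_measure G n k :
  measurable (init_seg G n k : set Omega) /\
  run_measure (init_seg G n k) = (stay A w G n k)%:E.
Proof.
set G' := fun i q q' => (n <= i)%N ==> G i q q'.
pose F q := if 0 < init q then cyl 0 (fun=> q) `&` seg G' 0 (n + k) else set0.
have EF : init_seg G n k = \bigcup_q F q.
  apply/seteqP; split => r.
    move=> [init_r sr]; exists (r 0%N); rewrite // /F init_r; split; first by case.
    by move=> i /sr[tr Gr]; split; rewrite // /G'; apply/implyP.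
  move=> [q _]; rewrite /F; case: ifP => // init_q [/(_ 0%N (leqnn _)) r0 sr].
  by split=> [|i /sr[tr /implyP Gr]] //; rewrite r0.
have mF q : measurable (F q : set Omega).
  by rewrite /F; case: ifP => // _; exact: (cyl_seg_measure _ _ _ _).1.
rewrite EF; split.
  by apply: fin_bigcup_measurable => [|q _]; [exact: finite_finset|exact: mF].
rewrite mu_bigcup_fin //; last first.
  move=> q q' _ _ [r' []]; rewrite /F; do 2 (case: ifP => // _).
  by move=> [+ _] [+ _] => /(_ 0%N (leqnn _)) + /(_ 0%N (leqnn _)) => -> .
rewrite -stay_init -sumEFin; apply: eq_bigr => q _; rewrite /F.
have [iq|] := ltP 0 (init q); last first.
  move=> iq; have -> : init q = 0 by apply/le_anti; rewrite iq init_ge0.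
  by rewrite /= measure0 !mul0r.
by rewrite (cyl_seg_measure _ _ _ _).2 /prefix_prob big_ord0 mulr1.
Qed.

Lemma eventE eta :
  event (A := A) w eta = \bigcup_n \bigcap_k init_seg (good A w eta) n k.
Proof.
apply/seteqP; split=> r.
  move=> [[init_r run_r] /LimInf_geP[n gn]]; exists n => // k _; split => // i _.
  by split; [exact: run_r|exact: gn].
move=> [n _ sr]; split; [split|].
- by have [] := sr 0%N I.
- by move=> i; have [_ /(_ i)[]] := sr i.+1 I; rewrite // addnS ltnS leq_addl.
- apply/LimInf_geP; exists n => i ni; have [_ /(_ i)[]] := sr i.+1 I => [|_ -> //].
  by rewrite addnS ltnS leq_addl.
Qed.

(** The event is the increasing union of these sets, each a decreasing intersection. Continuity of
    the measure, used twice, gives the event probability [sup_n inf_k stay n k]. *)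
Let tail eta n : set Omega := \bigcap_k init_seg (good A w eta) n k.

Let mtail eta n : measurable (tail eta n).
Proof. by apply: bigcap_measurable => // k _; exact: (init_seg_measure _ _ _).1. Qed.

Let tail_cvg eta n : (fun k => (stay A w (good A w eta) n k)%:E) @ \oo --> run_measure (tail eta n).
Proof.
have <- : run_measure \o init_seg (good A w eta) n =
    fun k => (stay A w (good A w eta) n k)%:E.
  by apply/funext => k; exact: (init_seg_measure _ _ _).2.
apply: nonincreasing_cvg_mu.
- by have := ltry (stay A w (good A w eta) n 0); rewrite -(init_seg_measure _ _ _).2.
- by move=> k; exact: (init_seg_measure _ _ _).1.
- exact: mtail.
move=> k l kl; apply/subsetPset => r [ir sr]; split=> // i ink.
by apply: sr; apply: leq_trans ink _; rewrite leq_add2l.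
Qed.

Let tail_le_stay eta n k : (run_measure (tail eta n) <= (stay A w (good A w eta) n k)%:E)%E.
Proof.
rewrite -(init_seg_measure _ _ _).2; apply: le_measure; rewrite ?inE.
- exact: mtail.
- exact: (init_seg_measure _ _ _).1.
- by move=> r; apply.
Qed.

Let le_tail eta n (c : R) : (forall k, c <= stay A w (good A w eta) n k) ->
  (c%:E <= run_measure (tail eta n))%E.
Proof.
by move=> le_c; apply: (cvge_to_ge (@tail_cvg eta n)); apply: nearW => k; rewrite lee_fin.
Qed.

Let event_cvg eta : run_measure \o tail eta @ \oo --> P (event (A := A) w eta).
Proof.
have mE : measurable (event (A := A) w eta : set Omega).
  by rewrite eventE; apply: bigcup_measurable => n _; exact: mtail.
rewrite -run_measureE // eventE.
apply: (@nondecreasing_cvg_mu _ Omega R run_measure (tail eta)) => [n||n m nm].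
- exact: mtail.
- by rewrite -eventE.
- apply/subsetPset => r sr k _; have [ir {}sr] := sr (m + k)%N I.
  split=> // i imk; have [|tr Gr] := sr i; first by rewrite (leq_trans imk) ?leq_addl.
  by split=> // mi; apply: Gr; apply: leq_trans mi.
Qed.

Let tail_le_event eta n : (run_measure (tail eta n) <= P (event (A := A) w eta))%E.
Proof.
have mE : measurable (event (A := A) w eta : set Omega).
  by rewrite eventE; apply: bigcup_measurable => m _; exact: mtail.
rewrite -(run_measureE mE) eventE; apply: le_measure; rewrite ?inE -?eventE //.
by rewrite eventE => r tr; exists n.
Qed.

Lemma event_gt0P eta : (0 < P (event (A := A) w eta))%E <->
  exists n, exists2 c, 0 < c & forall k, c <= stay A w (good A w eta) n k.
Proof.
split=> [E0|[n [c c0 /le_tail le_c]]]; last first.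
  by apply: lt_le_trans (tail_le_event eta n); apply: lt_le_trans le_c; rewrite lte_fin.
apply: contrapT => no_c; move: E0; rewrite ltNge => /negP; apply.
apply: (cvge_to_le (@event_cvg eta)); apply: nearW => n /=.
rewrite leNgt; apply/negP => tail0; apply: no_c; exists n.
have := @tail_le_stay eta n; case: run_measure tail0 => [c||] //; last by move=> _ /(_ 0%N).
by rewrite lte_fin => c0 le_c; exists c.
Qed.

Lemma event_eq1P eta : P (event (A := A) w eta) = 1%E <->
  forall e, 0 < e -> exists n, forall k, 1 - e <= stay A w (good A w eta) n k.
Proof.
have [_ _ _ PT _] := PP.
split=> [E1 e e0|le_e]; last first.
  apply/eqP; rewrite eq_le; apply/andP; split.
    apply: (cvge_to_le (@event_cvg eta)); apply: nearW => n /=.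
    by apply: (le_trans (tail_le_stay eta n 0)); rewrite lee_fin stay_le1.
  apply/lee_subgt0Pr => e /le_e[n /le_tail le_n].
  by apply: le_trans (tail_le_event eta n).
apply: contrapT => no_n; suff : (P (event (A := A) w eta) <= (1 - e)%:E)%E.
  by rewrite E1 lee_fin; lra.
apply: (cvge_to_le (@event_cvg eta)); apply: nearW => n /=.
rewrite leNgt; apply/negP => tail_gt; apply: no_n; exists n => k.
by rewrite -lee_fin; apply: le_trans (tail_le_stay eta n k); apply: ltW.
Qed.

End RunMeasure.

(** * Existence of the run measure *)

Section Sampling.
Context {R : realType} {S : finType}.
Implicit Types (p : S -> R) (q : S) (u : R).

Definition cum p (k : nat) : R := \sum_(q | (enum_rank q < k)%N) p q.

Lemma cumS p q : cum p (enum_rank q).+1 = cum p (enum_rank q) + p q.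
Proof.
rewrite /cum (bigD1 q) ?ltnSn //= addrC; congr (_ + _); apply: eq_bigl => q'.
by rewrite ltnS ltn_neqAle (inj_eq val_inj) (inj_eq enum_rank_inj) andbC.
Qed.

Lemma le_cum p k l : (forall q, 0 <= p q) -> (k <= l)%N -> cum p k <= cum p l.
Proof.
move=> p0 kl; rewrite /cum big_mkcond [leRHS]big_mkcond; apply: ler_sum => q _.
by case: ifPn => [/leq_trans -> //|_]; case: ifP.
Qed.

Lemma cum0 p : cum p 0 = 0.
Proof. by rewrite /cum big_pred0. Qed.

Lemma cum_card p : cum p #|S| = \sum_q p q.
Proof. by apply: eq_bigl => q; rewrite ltn_ord. Qed.

Lemma cum_bounds p q u : (forall q, 0 <= p q) -> \sum_q p q = 1 ->
  cum p (enum_rank q) <= u < cum p (enum_rank q).+1 -> 0 <= u < 1.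
Proof.
move=> p0 p1 /andP[lu ur].
have := le_cum p0 (leq0n (enum_rank q)); have := le_cum p0 (ltn_ord (enum_rank q)).
rewrite cum0 cum_card p1; lra.
Qed.

(** Inverse transform sampling. For a distribution [p], the default [q0] is reached only when [u]
    lies outside [[0, 1[]. *)
Definition sample (q0 : S) p u : S :=
  odflt q0 [pick q | cum p (enum_rank q) <= u < cum p (enum_rank q).+1].

Lemma sampleE q0 p u q : (forall q, 0 <= p q) -> \sum_q p q = 1 -> 0 <= u < 1 ->
  sample q0 p u = q <-> cum p (enum_rank q) <= u < cum p (enum_rank q).+1.
Proof.
move=> p0 p1 /andP[u0 u1].
have uniq_q q1 q2 : cum p (enum_rank q1) <= u < cum p (enum_rank q1).+1 ->
    cum p (enum_rank q2) <= u < cum p (enum_rank q2).+1 -> q1 = q2.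
  move=> /andP[l1 r1] /andP[l2 r2]; apply: enum_rank_inj; apply: val_inj => /=.
  apply/eqP; rewrite eqn_leq; apply/andP; split; rewrite leqNgt; apply/negP => h.
    by have := le_cum p0 h; lra.
  by have := le_cum p0 h; lra.
rewrite /sample; case: pickP => [q' q'P|none] /=.
  by split=> [<- //|/(uniq_q _ _ q'P)].
exfalso.
(* The least index whose cumulative sum exceeds [u] designates the sampled state. *)
have ex_k : exists k, (k <= #|S|)%N && (u < cum p k).
  by exists #|S|; rewrite leqnn cum_card p1.
case: (ex_minnP ex_k) => -[|k] /andP[kS uk] min_k; first by rewrite cum0 ltNge u0 in uk.
have := none (enum_val (Ordinal kS)); rewrite enum_valK /= uk andbT leNgt => /negbFE uk'.
by have := min_k k; rewrite uk' (ltnW kS) ltnn => /(_ isT).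
Qed.

End Sampling.

Lemma init_inhabited (R : realType) (Sigma : finType) (A : pwa R Sigma) :
  exists q : state A, 0 < init q.
Proof. by apply: sum_gt0_ex; rewrite init_sum1. Qed.

Section Existence.
Context {R : realType} {Sigma : finType} (A : pwa R Sigma) (w : nat -> Sigma).

(* Read a point [u] of [0, 1[ as a run: each state is sampled from [u], which is
   then rescaled to [0, 1[, so that every cylinder corresponds to an interval
   whose length is its probability. *)
Let step q0 (p : state A -> R) u :=
  let q := sample q0 p u in (q, (u - cum p (enum_rank q)) / p q).

Fixpoint decode q0 (u : R) n : state A * R :=
  if n is n'.+1 then
    let x := decode q0 u n' in step q0 (trans x.1 (w n')) x.2
  else step q0 (@init _ _ A) u.

Let left_end := fix left_end (r : nat -> state A) n : R :=
  if n is n'.+1 then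
    left_end r n' + prefix_prob w n' r * cum (trans (r n') (w n')) (enum_rank (r n))
  else cum (@init _ _ A) (enum_rank (r 0%N)).

Let prefix_probS r n :
  prefix_prob (A := A) w n.+1 r = prefix_prob w n r * trans (r n) (w n) (r n.+1).
Proof. by rewrite /prefix_prob big_ord_recr /= mulrA. Qed.

Let prefix_prob_ge0 (r : nat -> state A) n : 0 <= prefix_prob w n r.
Proof. by rewrite mulr_ge0 ?init_ge0 // prodr_ge0 // => i _; exact: trans_ge0. Qed.

Let decode_itv q0 r n u :
  (0 <= u < 1 /\ forall i, (i <= n)%N -> (decode q0 u i).1 = r i) <->
  left_end r n <= u < left_end r n + prefix_prob w n r.
Proof.
(* The induction must also carry the rescaled position of [u] inside its interval. *)
suff : ((0 <= u < 1 /\ forall i, (i <= n)%N -> (decode q0 u i).1 = r i) <->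
  left_end r n <= u < left_end r n + prefix_prob w n r) /\
  (left_end r n <= u < left_end r n + prefix_prob w n r ->
    (decode q0 u n).2 = (u - left_end r n) / prefix_prob w n r) by case.
elim: n => [|n [IH IH2]].
  rewrite /= /prefix_prob big_ord0 mulr1 -cumS.
  have sP := sampleE q0 (r 0%N) (@init_ge0 _ _ A) (init_sum1 A).
  have u01 := cum_bounds (@init_ge0 _ _ A) (init_sum1 A).
  split=> [|ur]; last first.
    by suff -> : sample q0 (@init _ _ A) u = r 0%N by []; apply/sP => //; exact: u01 ur.
  split=> [[u01' /(_ 0%N (leqnn _)) /= /sP -> //]|ur].
  by split=> [|i]; [exact: u01 ur|rewrite leqn0 => /eqP ->; apply/sP => //; exact: u01 ur].
set a := left_end r n in IH IH2 *; set l := prefix_prob w n r in IH IH2 *.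
have -> : left_end r n.+1 = a + l * cum (trans (r n) (w n)) (enum_rank (r n.+1)) by [].
have -> : prefix_prob w n.+1 r = l * trans (r n) (w n) (r n.+1) by exact: prefix_probS.
have p0 := trans_ge0 (r n) (w n); have p1 := trans_sum1 (r n) (w n).
set p := trans (r n) (w n) in p0 p1 *; set c := cum p _; set d := p _.
have cumE : cum p (enum_rank (r n.+1)).+1 = c + d by exact: cumS.
have l0 : 0 <= l by exact: prefix_prob_ge0.
have vP : a <= u < a + l -> 0 < l /\ 0 <= (u - a) / l < 1.
  move=> /andP[au ual]; have lgt0 : 0 < l by lra.
  by rewrite lgt0 ler_pdivlMr // ltr_pdivrMr //; split=> //; lra.
have scale : 0 < l -> (c <= (u - a) / l < c + d) = (a + l * c <= u < a + l * c + l * d).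
  move=> lgt0; rewrite ler_pdivlMr // ltr_pdivrMr // [_ * l]mulrC mulrDl.
  by rewrite -addrA -mulrDr -[in RHS]lerBrDl -[in RHS]ltrBlDl [l * (c + d)]mulrDr ![l * _]mulrC.
have inner : a + l * c <= u < a + l * c + l * d -> 0 < l /\ a <= u < a + l.
  move=> /andP[h1 h2]; have d0 : 0 <= d by exact: p0.
  have lgt0 : 0 < l by rewrite lt0r l0 andbT; apply/eqP => l_eq0; move: h1 h2; rewrite l_eq0; lra.
  split=> //; have := scale lgt0; rewrite h1 h2 -cumE => /(cum_bounds p0 p1).
  by rewrite ler_pdivlMr // ltr_pdivrMr //; lra.
have last_state : a <= u < a + l -> decode q0 u n.+1 = step q0 p ((u - a) / l).
  by move=> ual; rewrite /= IH2 // (IH.2 ual).2.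
split=> [|ur]; last first.
  have [lgt0 ual] := inner ur; have [_ v01] := vP ual.
  rewrite last_state //= /step; have -> : sample q0 p ((u - a) / l) = r n.+1.
    by apply/sampleE; rewrite // cumE scale.
  have dgt0 : 0 < d.
    by rewrite -(pmulr_rgt0 _ lgt0); case/andP: ur; lra.
  by rewrite -/c -/d /=; field; rewrite !gt_eqF.
split=> [[u01 dec]|ur].
  have ual : a <= u < a + l by apply/IH; split=> // i ?; apply: dec; exact: leqW.
  have [lgt0 v01] := vP ual; rewrite -scale // -cumE; apply/(sampleE q0) => //.
  by have := dec n.+1 (leqnn _); rewrite last_state.
have [lgt0 ual] := inner ur; have [_ v01] := vP ual; have [u01 dec] := IH.2 ual.
split=> // i; rewrite leq_eqVlt => /orP[/eqP ->|]; last exact: dec.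
by rewrite last_state //=; apply/sampleE; rewrite // cumE scale.
Qed.

(** The image of Lebesgue measure on [[0, 1[] under decoding. *)
Lemma run_measure_exists : exists P, is_run_measure (A := A) w P.
Proof.
have [q0 _] := init_inhabited A.
pose f u := fun n => (decode q0 u n).1.
pose I01 : set R := [set` `[0, 1[].
have f_cyl r n : I01 `&` f @^-1` (cyl n r) =
    [set` `[left_end r n, left_end r n + prefix_prob w n r[].
  by apply/seteqP; split=> u; rewrite /I01 /= !in_itv /=; have [] := decode_itv q0 r n u; tauto.
(* The sets with Borel preimage form a sigma-algebra, so it suffices to check cylinders. *)
have mf X : <<s (@cylinders _ _ A)>> X -> measurable (I01 `&` f @^-1` X).
  have mI01 : measurable I01 by exact: measurable_itv.
  apply: (@smallest_sub _ _ _ (image_set_system I01 f measurable)).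
    apply: sigma_algebra_image; split=> // [Y mY|F mF]; first exact: measurableD.
    exact: bigcupT_measurable.
  by move=> _ [n [r ->]]; rewrite /image_set_system /= f_cyl; exact: measurable_itv.
exists (fun X => lebesgue_measure (I01 `&` f @^-1` X)); split.
- by rewrite preimage_set0 setI0 measure0.
- by move=> X _; exact: measure_ge0.
- move=> F mF tF; rewrite preimage_bigcup setI_bigcupr.
  have sumE n : (\sum_(k < n) lebesgue_measure (I01 `&` f @^-1` F k) =
      \sum_(0 <= k < n) lebesgue_measure (I01 `&` f @^-1` F k))%E by rewrite big_mkord.
  under eq_fun do rewrite sumE.
  apply: measure_semi_sigma_additive => [k||]; first exact: mf.
    by move=> i j _ _ [u [[_ Fi] [_ Fj]]]; apply: tF => //; exists (f u).
  by apply: bigcup_measurable => k _; exact: mf.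
- rewrite preimage_setT setIT lebesgue_measure_itv /= lte_fin ltr01 oppr0 adde0 //.
- move=> n r; rewrite f_cyl lebesgue_measure_itv /= lte_fin ltrDl.
  have := prefix_prob_ge0 r n; rewrite le_eqVlt => /orP[/eqP <-|l0]; first by rewrite ltxx.
  by rewrite l0 -EFinB addrAC subrr add0r.
Qed.

End Existence.

(** * The three semantics in terms of survival probabilities *)

Section Characterizations.
Context {R : realType} {Sigma : finType} (A : pwa R Sigma) (w : nat -> Sigma).

Implicit Types (eta : R) (G : nat -> state A -> state A -> bool).

Definition possible eta := exists n, forall k, 0 < stay A w (good A w eta) n k.

Definition positive eta :=
  exists n, exists2 c, 0 < c & forall k, c <= stay A w (good A w eta) n k.

Definition almost_sure eta :=
  forall e, 0 < e -> exists n, forall k, 1 - e <= stay A w (good A w eta) n k.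

(** [LPos] quantifies over all run measures: existence supplies one to instantiate, and the
    resulting condition on [stay] mentions no measure. *)
Lemma LPosE : LPos A w = level_sup positive.
Proof.
have [q0 _] := init_inhabited A; have [P PP] := run_measure_exists A w.
apply: level_sup_ext => eta; split=> [/(_ P PP)|pos P' PP'].
  by move/(event_gt0P q0 PP).
exact/(event_gt0P q0 PP').
Qed.

Lemma LAsE : LAs A w = level_sup almost_sure.
Proof.
have [q0 _] := init_inhabited A; have [P PP] := run_measure_exists A w.
apply: level_sup_ext => eta; split=> [/(_ P PP)|pos P' PP'].
  by move/(event_eq1P q0 PP).
exact/(event_eq1P q0 PP').
Qed.

Lemma good_le eta eta' i q q' : eta <= eta' -> good A w eta' i q q' -> good A w eta i q q'.
Proof. exact: le_trans. Qed.

Lemma stay_le G G' n k : (forall j q q', (n <= j)%N -> G j q q' -> G' j q q') ->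
  stay A w G n k <= stay A w G' n k.
Proof.
move=> GG'; apply: ler_sum => q _; rewrite ler_wpM2l ?law_ge0 //; exact: surv_le.
Qed.

Lemma positive_le eta eta' : eta <= eta' -> positive eta' -> positive eta.
Proof.
move=> le_eta [n [c c0 le_c]]; exists n, c => // k; apply: le_trans (le_c k) _.
by apply: stay_le => j q q' _; exact: good_le.
Qed.

Lemma almost_sure_le eta eta' : eta <= eta' -> almost_sure eta' -> almost_sure eta.
Proof.
move=> le_eta As e /As[n le_n]; exists n => k; apply: le_trans (le_n k) _.
by apply: stay_le => j q q' _; exact: good_le.
Qed.

Lemma surv_gt0_next G i q : (forall k, 0 < surv A w G i k q) ->
  exists q', [/\ 0 < trans q (w i) q', G i q q' & forall k, 0 < surv A w G i.+1 k q'].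
Proof.
move=> alive.
have [||q' q'P] := @finite_persistent _ (fun q' k =>
    0 < trans q (w i) q' * (G i q q')%:R * surv A w G i.+1 k q').
- move=> q' k l kl /lt_le_trans; apply.
  by rewrite ler_wpM2l ?surv_antitone // mulr_ge0 ?trans_ge0.
- by move=> k; exact: sum_gt0_ex (alive k.+1).
exists q'; split.
- by rewrite lt0r trans_ge0 andbT; apply: contraTneq (q'P 0%N) => ->; rewrite !mul0r ltxx.
- by apply: contraTT (q'P 0%N) => /negbTE ->; rewrite mulr0 mul0r ltxx.
- by move=> k; rewrite lt0r surv_ge0 andbT; apply: contraTneq (q'P k) => ->; rewrite mulr0 ltxx.
Qed.

Lemma stay_gt0_persistent G n : (forall k, 0 < stay A w G n k) ->
  exists2 q, 0 < law A w n q & forall k, 0 < surv A w G n k q.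
Proof.
move=> alive.
have [||q qP] := @finite_persistent _ (fun q k => 0 < law A w n q * surv A w G n k q).
- by move=> q k l kl /lt_le_trans; apply; rewrite ler_wpM2l ?law_ge0 ?surv_antitone.
- by move=> k; exact: sum_gt0_ex (alive k).
exists q; first by rewrite lt0r law_ge0 andbT; apply: contraTneq (qP 0%N) => ->; rewrite mul0r ltxx.
by move=> k; rewrite lt0r surv_ge0 andbT; apply: contraTneq (qP k) => ->; rewrite mulr0 ltxx.
Qed.

(** Koenig's lemma: among the finitely many successors of a state that survives for all lengths, one
    again survives for all lengths. *)
Lemma possibleP eta : (exists r, event (A := A) w eta r) <-> possible eta.
Proof.
split=> [[r [[init_r run_r] /LimInf_geP[n gn]]]|[n alive]].
  have law_gt0 i : 0 < law A w i (r i).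
    elim: i => // i IH /=; rewrite (bigD1 (r i)) //=; apply: ltr_pwDl.
      by rewrite mulr_gt0.
    by apply: sumr_ge0 => q _; rewrite mulr_ge0 ?law_ge0 ?trans_ge0.
  have surv_gt0 k i : (n <= i)%N -> 0 < surv A w (good A w eta) i k (r i).
    elim: k i => // k IH i ni /=; rewrite (bigD1 (r i.+1)) //=; apply: ltr_pwDl.
      by rewrite gn // mulr1 mulr_gt0 // IH // leqW.
    by apply: sumr_ge0 => q _; rewrite !mulr_ge0 ?surv_ge0 ?trans_ge0.
  exists n => k; rewrite /stay (bigD1 (r n)) //=; apply: ltr_pwDl.
    by rewrite mulr_gt0 // surv_gt0.
  by apply: sumr_ge0 => q _; rewrite mulr_ge0 ?law_ge0 ?surv_ge0.
(* Masking the constraint before [n] lets the whole run be built from time 0. *)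
set G := fun i q q' => (n <= i)%N ==> good A w eta i q q'.
have [q0 init_q0 alive_q0] : exists2 q0 : state A, 0 < init q0 &
    forall k, 0 < surv A w G 0 k q0.
  apply: (@stay_gt0_persistent G 0%N) => k; apply: lt_le_trans (alive k) _.
  rewrite -stay_init; apply: ler_sum => q _.
  by rewrite ler_wpM2l ?init_ge0 // surv_antitone // leq_addl.
have /choice[next nextP] (x : nat * state A) : exists q',
    (forall k, 0 < surv A w G x.1 k x.2) ->
    [/\ 0 < trans x.2 (w x.1) q', G x.1 x.2 q' & forall k, 0 < surv A w G x.1.+1 k q'].
  have [/surv_gt0_next[q' ?]|dead] := pselect (forall k, 0 < surv A w G x.1 k x.2).
    by exists q'.
  by exists q0.
pose r := fix r i := if i is j.+1 then next (j, r j) else q0.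
have alive_r i k : 0 < surv A w G i k (r i).
  by elim: i k => // i IH; have [_ _] := nextP (i, r i) IH.
have rP i : 0 < trans (r i) (w i) (r i.+1) /\ G i (r i) (r i.+1).
  by have [] := nextP (i, r i) (alive_r i).
exists r; split; first by split=> // i; case: (rP i).
by apply/LimInf_geP; exists n => i ni; have [_] := rP i; rewrite /G ni.
Qed.

Lemma LMaxE : LMax A w = level_sup possible.
Proof. by rewrite LMax_level_sup; apply: level_sup_ext; exact: possibleP. Qed.

Lemma positive_possible eta : positive eta -> possible eta.
Proof. by move=> [n [c c0 le_c]]; exists n => k; exact: lt_le_trans (le_c k). Qed.

Lemma possible_le eta eta' : eta <= eta' -> possible eta' -> possible eta.
Proof.
move=> le_eta [n gt0]; exists n => k; apply: lt_le_trans (gt0 k) _.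
by apply: stay_le => j q q' _; exact: good_le.
Qed.

End Characterizations.
Arguments possible {R Sigma} A w eta.
Arguments positive {R Sigma} A w eta.
Arguments almost_sure {R Sigma} A w eta.

(** * From nondeterministic to positive semantics *)

Lemma sum_indicator (R : pzSemiRingType) (I : finType) (a : I) :
  \sum_i (i == a)%:R = 1 :> R.
Proof. by rewrite (bigD1 a) //= eqxx big1 ?addr0 // => i /negbTE ->. Qed.

Section Push.
Context {R : realType} {Y X : finType} (m : Y -> R) (g : Y -> X).
Hypothesis m_ge0 : forall y, 0 <= m y.

(** The image distribution of [m] under [g]. With it a pwa can be specified by its random moves, and
    sums over states become sums over moves. *)
Definition push (x : X) : R := \sum_y m y * (x == g y)%:R.

Lemma push_ge0 x : 0 <= push x.
Proof. by apply: sumr_ge0 => y _; rewrite mulr_ge0. Qed.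

Lemma push_sum (F : X -> R) : \sum_x push x * F x = \sum_y m y * F (g y).
Proof.
under eq_bigr do rewrite mulr_suml.
rewrite exchange_big /=; apply: eq_bigr => y _.
rewrite (bigD1 (g y)) //= eqxx mulr1 big1 ?addr0 // => x /negbTE ->.
by rewrite mulr0 mul0r.
Qed.

Lemma push_sum1 : \sum_x push x = \sum_y m y.
Proof.
have /= := push_sum (fun=> 1); under eq_bigr do rewrite mulr1.
by under [in RHS]eq_bigr do rewrite mulr1.
Qed.

Lemma push_gt0P x : 0 < push x <-> exists2 y, 0 < m y & x = g y.
Proof.
split=> [/sum_gt0_ex[y]|[y my ->]].
  case: eqP => [-> |_]; last by rewrite mulr0 ltxx.
  by rewrite mulr1; exists y.
rewrite /push (bigD1 y) //= eqxx mulr1 ltr_pwDl // sumr_ge0 // => y' _.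
by rewrite mulr_ge0.
Qed.

End Push.

Lemma uniform_sum1 (R : realType) (T : finType) (t0 : T) : \sum_(t : T) #|T|%:R^-1 = 1 :> R.
Proof.
rewrite sumr_const -[LHS]mulr_natr mulVf // pnatr_eq0 -lt0n.
by apply/card_gt0P; exists t0.
Qed.

Lemma stay_all (R : realType) (Sigma : finType) (A : pwa R Sigma) w
    (G : nat -> state A -> state A -> bool) n k :
  (forall i q q', G i q q') -> stay A w G n k = 1.
Proof.
move=> allG; rewrite -(law_sum1 A w n); apply: eq_bigr => q _.
suff -> : surv A w G n k q = 1 by rewrite mulr1.
elim: k n q => // k IH n q /=; rewrite -[RHS](trans_sum1 q (w n)).
by apply: eq_bigr => q' _; rewrite IH allG !mulr1.
Qed.

Section Supports.
Context {R : realType} {Sigma : finType} (A : pwa R Sigma).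

Definition post (S : {set state A}) (s : Sigma) : {set state A} :=
  [set q' | [exists q, (q \in S) && (0 < trans q s q')]].

Lemma postP (U : {set state A}) s q' :
  reflect (exists2 q, q \in U & 0 < trans q s q') (q' \in post U s).
Proof.
rewrite finset.in_set; apply: (iffP existsP) => -[q].
  by case/andP; exists q.
by move=> qU tq; exists q; rewrite qU.
Qed.

Definition supp0 : {set state A} := [set q | 0 < init q].

Lemma law0_gt0 w q : (0 < law A w 0 q) = (q \in supp0).
Proof. by rewrite inE. Qed.

Lemma lawS_gt0 w n (S : {set state A}) : (forall q, (0 < law A w n q) = (q \in S)) ->
  forall q, (0 < law A w n.+1 q) = (q \in post S (w n)).
Proof.
move=> nS q; apply/idP/postP.
  rewrite lawS => /sum_gt0_ex[q' q'P]; exists q'.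
    by rewrite -nS lt0r law_ge0 andbT; apply: contraTneq q'P => ->; rewrite mul0r ltxx.
  by rewrite lt0r trans_ge0 andbT; apply: contraTneq q'P => ->; rewrite mulr0 ltxx.
move=> [q' q'S tq]; rewrite lawS (bigD1 q') //=; apply: ltr_pwDl.
  by rewrite mulr_gt0 // nS.
by apply: sumr_ge0 => q1 _; rewrite mulr_ge0 ?law_ge0 ?trans_ge0.
Qed.

End Supports.

Section Deterministic.
Context {R : realType} {Sigma : finType} (B : pwa R Sigma).
Variable f : state B -> Sigma -> state B.
Hypothesis trans_f : forall q s q', trans q s q' = (q' == f q s)%:R.

(** Only one path leaves [q], so survival has probability 0 or 1. *)
Lemma surv_det w G i k q : 0 < surv B w G i k q -> surv B w G i k q = 1.
Proof.
elim: k i q => [|k IH] i q //=.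
rewrite (bigD1 (f q (w i))) //= trans_f eqxx mul1r big1 ?addr0; last first.
  by move=> q' /negbTE nq'; rewrite trans_f nq' !mul0r.
by case: (G _ _ _) => /=; rewrite ?mul0r ?ltxx // !mul1r; exact: IH.
Qed.

(** A state that survives for all lengths does so with probability 1, so its own mass at time [n] is
    the lower bound. *)
Lemma det_positiveE w eta : positive B w eta <-> possible B w eta.
Proof.
split=> [|[n /stay_gt0_persistent[q lq alive]]]; first exact: positive_possible.
exists n, (law B w n q) => // k; rewrite /stay (bigD1 q) //= surv_det // mulr1.
by rewrite lerDl sumr_ge0 // => q' _; rewrite mulr_ge0 ?law_ge0 ?surv_ge0.
Qed.

End Deterministic.

Section WeightLevels.
Context {R : realType} {Sigma : finType} (A : pwa R Sigma).

(** Edges stand for the weights they carry, which makes the thresholds a finite type. *)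
Definition edge : finType := (state A * Sigma * state A)%type.
Definition edge_weight (t : edge) : rat := weight t.1.1 t.1.2 t.2.

Lemma min_edge_ex (q0 : state A) (s0 : Sigma) :
  exists t0, forall t, edge_weight t0 <= edge_weight t.
Proof.
pose t1 : edge := (q0, s0, q0).
case: (@Order.TotalTheory.arg_minP _ _ _ t1 xpredT edge_weight isT) => t0 _ t0P.
by exists t0 => t; exact: t0P.
Qed.

Lemma max_edge_ex (q0 : state A) (s0 : Sigma) :
  exists t0, forall t, edge_weight t <= edge_weight t0.
Proof.
pose t1 : edge := (q0, s0, q0).
case: (@Order.TotalTheory.arg_maxP _ _ _ t1 xpredT edge_weight isT) => t0 _ t0P.
by exists t0 => t; exact: t0P.
Qed.

End WeightLevels.
Arguments edge_weight {R Sigma} A t.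

(* The breakpoint construction of Miyano and Hayashi, for a weight threshold
   guessed in the first step: [U] is the set of reachable states, [V] the set of
   states reached from the last breakpoint with weights at least the threshold,
   and a breakpoint occurs when [V] would become empty. *)
Section Breakpoint.
Context {R : realType} {Sigma : finType} (A : pwa R Sigma).
Let T := edge A.
Variable t0 : T.
Hypothesis t0_min : forall t, edge_weight A t0 <= edge_weight A t.

Let BS : finType := (T * {set state A} * {set state A} * bool)%type.

Definition post_ge (t : T) (O : {set state A}) (s : Sigma) : {set state A} :=
  [set q' | [exists q, [&& q \in O, 0 < trans q s q' & edge_weight A t <= weight q s q']]].

Lemma post_geP t (V : {set state A}) s q' :
  reflect (exists q, [/\ q \in V, 0 < trans q s q' & edge_weight A t <= weight q s q'])
    (q' \in post_ge t V s).
Proof.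
rewrite finset.in_set; apply: (iffP existsP) => -[q]; first by case/and3P; exists q.
by case=> *; exists q; apply/and3P.
Qed.

Definition bp_start (t : T) : BS := (t, supp0 A, supp0 A, false).

Definition bp_next (x : BS) (s : Sigma) : BS :=
  let: (t, U, V, _) := x in
  if post_ge t V s == finset.set0 then (t, post U s, post U s, false)
  else (t, post U s, post_ge t V s, true).

(** The flag [false] marks a breakpoint, which gets the least weight: infinitely many breakpoints
    yield a value that every run of [A] reaches anyway. *)
Definition bp_weight (x : BS) (s : Sigma) (x' : BS) : rat :=
  if x'.2 then edge_weight A x'.1.1.1 else edge_weight A t0.

Definition bp_trans (x : BS) (s : Sigma) (x' : BS) : R := (x' == bp_next x s)%:R.

Lemma bp_trans_ge0 x s x' : 0 <= bp_trans x s x'. Proof. exact: ler0n. Qed.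
Lemma bp_trans_sum1 x s : \sum_x' bp_trans x s x' = 1. Proof. exact: sum_indicator. Qed.

Definition bp_init : BS -> R := push (fun=> #|T|%:R^-1) bp_start.

Lemma bp_init_ge0 x : 0 <= bp_init x.
Proof. by apply: push_ge0 => t; rewrite invr_ge0. Qed.

Lemma bp_init_sum1 : \sum_x bp_init x = 1.
Proof. by rewrite push_sum1 (uniform_sum1 R t0). Qed.

Definition breakpoint_pwa : pwa R Sigma :=
  PWA bp_weight bp_init_ge0 bp_init_sum1 bp_trans_ge0 bp_trans_sum1.

Local Notation B := breakpoint_pwa.

(** If breakpoints stop, [V] stays nonempty along steps above the guessed threshold, which gives
    surviving paths of all lengths. Conversely, a run of [A] with value at least [eta] ends up
    inside [V] and prevents further breakpoints. *)
Lemma bp_possible w eta : possible B w eta <-> possible A w eta.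
Proof.
pose V (r : nat -> BS) i := (r i).1.2.
pose flag (r : nat -> BS) i := (r i).2.
have runP (r : nat -> BS) : is_run (A := B) w r <->
    (exists t, r 0%N = bp_start t) /\ forall i, r i.+1 = bp_next (r i) (w i).
  have invT0 : (0 : R) < #|T|%:R^-1.
    by rewrite invr_gt0 ltr0n; apply/card_gt0P; exists t0.
  rewrite /is_run /= /bp_init push_gt0P; last by move=> _; exact: ltW.
  split=> -[h0 hS]; split=> //; try by case: h0 => t; exists t.
    move=> i.
    by have := hS i; rewrite /bp_trans; case: eqP; rewrite ?ltxx.
  by move=> i; rewrite hS /bp_trans eqxx ltr01.
have run_inv (r : nat -> BS) t : r 0%N = bp_start t ->
    (forall i, r i.+1 = bp_next (r i) (w i)) ->
  forall i, [/\ (r i).1.1.1 = t, forall q, (0 < law A w i q) = (q \in (r i).1.1.2),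
    {subset V r i <= (r i).1.1.2} &
    flag r i.+1 = (post_ge t (V r i) (w i) != finset.set0) /\
    V r i.+1 = if flag r i.+1 then post_ge t (V r i) (w i) else (r i.+1).1.1.2].
  move=> r0 rS.
  have step i : (r i).1.1.1 = t ->
    [/\ (r i.+1).1.1.1 = t, (r i.+1).1.1.2 = post (r i).1.1.2 (w i),
      flag r i.+1 = (post_ge t (V r i) (w i) != finset.set0) &
      V r i.+1 = if flag r i.+1 then post_ge t (V r i) (w i) else (r i.+1).1.1.2].
    rewrite /V /flag rS; case: (r i) => [[[t1 S1] O1] b1] /= ->.
    by case: eqP.
  elim=> [|i [ti lawi subi [flagi Oi]]].
    have [] := step 0%N; rewrite /V ?r0 //= => _ _ flag1 O1; split => // q.
    exact: law0_gt0.
  have [tS SS _ _] := step _ ti; have [tSS SSS flagS OS] := step _ tS.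
  split=> //; first by rewrite SS; exact: lawS_gt0.
  rewrite Oi; case: ifP => _ q' //; rewrite SS => /post_geP[q [qV tq _]].
  by apply/postP; exists q => //; exact: subi.
rewrite -!possibleP; split=> [[r [/runP[[t r0] rS] /LimInf_geP[n gn]]]|].
  have inv := run_inv r t r0 rS; apply/possibleP.
  have [le_eta|lt_eta] := leP eta (ratr (edge_weight A t0)).
    exists 0%N => k; rewrite stay_all // => i q q'; apply: le_trans le_eta _.
    by rewrite ler_rat; exact: (t0_min (q, w i, q')).
  have flag_n i : (n <= i)%N -> flag r i.+1 /\ eta <= ratr (edge_weight A t).
    move=> /gn; rewrite /good /= /bp_weight /flag; have [-> _ _ _] := inv i.+1.
    by case: ifP => // _; rewrite leNgt lt_eta.
  (* Each state of [V] at time [i.+1] has a predecessor in [V] at time [i], so paths are traced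
     backwards from a later nonempty [V]. *)
  have alive k i : (n <= i)%N -> exists2 q, q \in V r i & 0 < surv A w (good A w eta) i k q.
    elim: k i => [|k IH] i ni.
      have [_ _ _ [flagi _]] := inv i; have [+ _] := flag_n i ni.
      rewrite flagi => /set0Pn[q' /post_geP[q [qV _ _]]].
      by exists q => //=; rewrite ltr01.
    have [q' + alive_q'] := IH i.+1 (leqW ni).
    have [_ _ _ [_ ->]] := inv i; have [-> le_t] := flag_n i ni.
    move=> /post_geP[q [qV tq wq]]; exists q => //=.
    rewrite (bigD1 q') //=; apply: ltr_pwDl; last first.
      by apply: sumr_ge0 => q1 _; rewrite !mulr_ge0 ?surv_ge0 ?trans_ge0.
    suff -> : good A w eta i q q' by rewrite mulr1 mulr_gt0.
    by rewrite /good; apply: le_trans le_t _; rewrite ler_rat.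
  exists n => k; have [q qV sq] := alive k n (leqnn _).
  have [_ lawn subn _] := inv n.
  rewrite /stay (bigD1 q) //=; apply: ltr_pwDl; first by rewrite mulr_gt0 // lawn subn.
  by apply: sumr_ge0 => q1 _; rewrite mulr_ge0 ?law_ge0 ?surv_ge0.
move=> [rA [[init_rA run_rA] /LimInf_geP[n gn]]].
(* The guess is the least weight reaching [eta], so that reaching [eta] implies reaching the
   guess. *)
have [t t_ge t_min] : exists2 t : T, eta <= ratr (edge_weight A t) &
    forall t', eta <= ratr (edge_weight A t') -> edge_weight A t <= edge_weight A t'.
  pose t1 : T := (rA n, w n, rA n.+1).
  case: (@Order.TotalTheory.arg_minP _ _ _ t1 [pred t : T | eta <= ratr (edge_weight A t)]
    (edge_weight A) (gn n (leqnn n))) => t tP tmin.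
  by exists t.
pose r := fix r i := if i is j.+1 then bp_next (r j) (w j) else bp_start t.
have inv := run_inv r t erefl (fun=> erefl).
have law_rA i : 0 < law A w i (rA i).
  elim: i => // i IH /=; rewrite (bigD1 (rA i)) //=; apply: ltr_pwDl.
    by rewrite mulr_gt0.
  by apply: sumr_ge0 => q _; rewrite mulr_ge0 ?law_ge0 ?trans_ge0.
have tracked i : (n <= i)%N -> rA i \in V r i -> flag r i.+1 /\ rA i.+1 \in V r i.+1.
  move=> ni rV; have [_ _ _ [flagi ->]] := inv i.
  have rpost : rA i.+1 \in post_ge t (V r i) (w i).
    apply/post_geP; exists (rA i); split=> //.
    exact: (t_min (rA i, w i, rA i.+1) (gn i ni)).
  have -> : flag r i.+1 by rewrite flagi; apply/set0Pn; exists (rA i.+1).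
  by [].
(* Either no breakpoint occurs from [n] on, or one resets [V] to the full support, which contains
   the run of [A]. *)
have [m [nm flag_m]] : exists m, (n <= m)%N /\ forall i, (m <= i)%N -> flag r i.+1.
  have [[j nj flagj]|no_bp] := pselect (exists2 j, (n <= j)%N & ~~ flag r j.+1); last first.
    exists n; split=> // i ni; apply: contrapT => /negP ?; apply: no_bp; by exists i.
  exists j.+1; split; first exact: leqW.
  have inV d : rA (j.+1 + d)%N \in V r (j.+1 + d)%N.
    elim: d => [|d IH]; last first.
      by rewrite addnS; have [||_ ->] := tracked (j.+1 + d)%N; rewrite ?IH //; lia.
    rewrite addn0; have [_ lawj _ _] := inv j.+1; have [_ _ _ [_ ->]] := inv j.
    by rewrite (negbTE flagj) -lawj.
  move=> i ji; have [] := tracked i; rewrite ?(leq_trans _ ji) ?leqW //.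
  by have := inV (i - j.+1)%N; rewrite subnKC.
exists r; split; first by apply/runP; split; [exists t|].
apply/LimInf_geP; exists m => i mi.
by rewrite /good /= /bp_weight -/(flag r i.+1) flag_m //; have [-> _ _ _] := inv i.+1.
Qed.

End Breakpoint.

Lemma NLimInf_reducible_PosLimInf (R : realType) : reducible (@NLimInf R) (@PosLimInf R).
Proof.
move=> Sigma A; have [q0 _] := init_inhabited A.
(* Over an empty alphabet there are no words to compare and no edges to choose from. *)
have [s0|no_s] := pickP (@predT Sigma); last first.
  by exists A => w; have := no_s (w 0%N).
move=> _; have [t0 t0_min] := min_edge_ex q0 s0.
exists (breakpoint_pwa t0) => w; rewrite /NLimInf /PosLimInf LMaxE LPosE.
apply: level_sup_ext => eta; rewrite -(bp_possible t0_min); apply: iff_sym.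
exact: (@det_positiveE _ _ (breakpoint_pwa t0) (@bp_next _ _ A)).
Qed.

(** * From positive to almost-sure semantics *)

Section Recovery.
Context {R : realType} {Sigma : finType} (A : pwa R Sigma) (w : nat -> Sigma).
Variable G : nat -> state A -> state A -> bool.

Let bad (j : nat) (q q' : state A) : R := trans q (w j) q' * (~~ G j q q')%:R.

(** The probability of a bad step at time [j]; [recovered] moreover requires the next [k] steps to
    be good. *)
Let inflow j : R := \sum_q law A w j q * \sum_q' bad j q q'.

Let recovered j k : R :=
  \sum_q law A w j q * \sum_q' bad j q q' * surv A w G j.+1 k q'.

Let bad_ge0 j q q' : 0 <= bad j q q'.
Proof. by rewrite mulr_ge0 ?trans_ge0. Qed.

Let stay_step n k : stay A w G n.+1 k = stay A w G n k.+1 + recovered n k.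
Proof.
rewrite /stay /recovered -big_split /=.
under eq_bigr do rewrite mulr_suml.
rewrite exchange_big /=; apply: eq_bigr => q _.
rewrite -mulrDr -big_split mulr_sumr /=; apply: eq_bigr => q' _.
by rewrite /bad; case: (G n q q') => /=; ring.
Qed.

(* Decomposition of the runs according to their last bad step before [n + d]. *)
Let last_bad n d : 1 = stay A w G n d + \sum_(i < d) recovered (n + i) (d - i.+1).
Proof.
elim: d n => [|d IH] n.
  by rewrite big_ord0 addr0 /stay -[LHS](law_sum1 A w n); apply: eq_bigr => q _; rewrite mulr1.
rewrite (IH n.+1) stay_step -addrA big_ord_recl addn0 subSS subn0; congr (_ + (_ + _)).
by apply: eq_bigr => i _; rewrite addSnnS.
Qed.

(* The hypothesis bounds the expected number of bad steps after time [N] by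
   [c^-1]. *)
Lemma stay_recovery N c : 0 < c ->
  (forall j q k, (N <= j)%N -> 0 < law A w j q ->
    c * \sum_q' trans q (w j) q' * (~~ G j q q')%:R <=
    \sum_q' trans q (w j) q' * (~~ G j q q')%:R * surv A w G j.+1 k q') ->
  forall e, 0 < e -> exists n, forall k, 1 - e <= stay A w G n k.
Proof.
move=> c0 rec_c e e0.
have rec_ge j k : (N <= j)%N -> c * inflow j <= recovered j k.
  move=> Nj; rewrite /inflow mulr_sumr; apply: ler_sum => q _.
  rewrite mulrCA; have := law_ge0 w j q; rewrite le_eqVlt => /orP[/eqP <-|lq].
    by rewrite !mul0r.
  by rewrite ler_pM2l //; exact: rec_c.
have rec_le j k : recovered j k <= inflow j.
  apply: ler_sum => q _; rewrite ler_wpM2l ?law_ge0 //; apply: ler_sum => q' _.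
  by rewrite ler_piMr ?surv_le1.
have inflow_ge0 j : 0 <= inflow j.
  by apply: sumr_ge0 => q _; rewrite mulr_ge0 ?law_ge0 // sumr_ge0.
pose E := [set \sum_(i < d) inflow (N + i) | d in [set: nat]].
have ubE : ubound E c^-1.
  move=> _ [d _ <-]; rewrite -[leRHS]mul1r ler_pdivlMr // mulrC mulr_sumr.
  rewrite (last_bad N d); apply: ler_wpDl; first exact: stay_ge0.
  by apply: ler_sum => i _; apply: rec_ge; exact: leq_addr.
have supE : has_sup E.
  by split; [exists 0; exists 0%N; rewrite ?big_ord0|exists c^-1].
(* Beyond [N + d] less than [e] of the expected bad steps remains, and by [last_bad] this bounds the
   loss of [stay]. *)
have [_ [d _ <-] sup_d] := sup_adherent e0 supE.
exists (N + d)%N => k; rewrite lerBlDr (last_bad (N + d) k) lerD2l.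
have le_sup : \sum_(i < d + k) inflow (N + i) <= sup E.
  by apply: ub_le_sup; [case: supE|exists (d + k)%N].
rewrite big_split_ord /= in le_sup.
apply: (@le_trans _ _ (\sum_(i < k) inflow (N + (d + i)))); last lra.
by apply: ler_sum => i _; rewrite addnA.
Qed.

End Recovery.

Section Restart.
Context {R : realType} {Sigma : finType} (A : pwa R Sigma).
Let T := edge A.
Variable tmax : T.
Hypothesis tmax_max : forall t, edge_weight A t <= edge_weight A tmax.

Let BS : finType := (T * bool * {set state A} * state A)%type.

Definition next_support (U : {set state A}) s : {set state A} :=
  if post U s == finset.set0 then [set: state A]%SET else post U s.

Definition uniform_on (U : {set state A}) q : R := (q \in U)%:R / #|U|%:R.

Definition heavy (t : T) (q : state A) (s : Sigma) (q' : state A) : bool :=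
  edge_weight A t < weight q s q'.

Definition failure t q s : R := \sum_q' trans q s q' * (~~ heavy t q s q')%:R.

(* One step of the component of [x]: simulate [A] as long as the weights exceed
   the level of [x], and otherwise restart, with flag [false], from a random
   state of the support. *)
Definition rs_move (x : BS) s (y : bool * state A) : R :=
  let: (t, _, U, q) := x in
  if y.1 then trans q s y.2 * (heavy t q s y.2)%:R
  else failure t q s * uniform_on (next_support U s) y.2.

Definition rs_target (x : BS) s (y : bool * state A) : BS :=
  (x.1.1.1, y.1, next_support x.1.2 s, y.2).

Definition rs_trans (x : BS) s : BS -> R := push (rs_move x s) (rs_target x s).

Definition rs_start (y : T * state A) : BS := (y.1, true, supp0 A, y.2).
Definition rs_init : BS -> R := push (fun y => #|T|%:R^-1 * init y.2) rs_start.

(** Level [t] yields the greatest weight if its restarts stop and the weight of [t] otherwise. The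
    least outcome over all levels is the positive value of [A]. *)
Definition rs_weight (x : BS) (s : Sigma) (x' : BS) : rat :=
  if x'.1.1.2 then edge_weight A tmax else edge_weight A x'.1.1.1.

Lemma next_support_neq0 U s : next_support U s != finset.set0.
Proof.
rewrite /next_support; case: ifPn => // _; have [q0 _] := init_inhabited A.
by apply/set0Pn; exists q0; rewrite finset.in_setT.
Qed.

Lemma card_next_support U s : (0 < #|next_support U s|)%N.
Proof. by rewrite card_gt0 next_support_neq0. Qed.

Lemma uniform_on_ge0 U q : 0 <= uniform_on U q.
Proof. by rewrite divr_ge0. Qed.

Lemma uniform_on_sum1 U : U != finset.set0 -> \sum_q uniform_on U q = 1.
Proof.
rewrite -card_gt0 => U0; rewrite -mulr_suml -natr_sum -big_mkcond sum1_card divff //.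
by rewrite pnatr_eq0 -lt0n.
Qed.

Lemma failure_ge0 t q s : 0 <= failure t q s.
Proof. by apply: sumr_ge0 => q' _; rewrite mulr_ge0 ?trans_ge0. Qed.

Lemma rs_move_ge0 x s y : 0 <= rs_move x s y.
Proof.
case: x => [[[t b] U] q] /=; case: ifP => _; first by rewrite mulr_ge0 ?trans_ge0.
by rewrite mulr_ge0 ?failure_ge0 ?uniform_on_ge0.
Qed.

Lemma sum_bool_pair (F : bool * state A -> R) :
  \sum_y F y = \sum_q F (true, q) + \sum_q F (false, q).
Proof.
transitivity (\sum_(y : bool * state A) F (y.1, y.2)); first by apply: eq_bigr => -[].
by rewrite -(pair_bigA _ (fun b q => F (b, q))) big_bool.
Qed.

Lemma rs_move_sum1 x s : \sum_y rs_move x s y = 1.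
Proof.
rewrite sum_bool_pair; case: x => [[[t b] U] q] /=.
rewrite -mulr_sumr uniform_on_sum1 ?next_support_neq0 // mulr1 /failure -big_split /=.
rewrite -[RHS](trans_sum1 q s); apply: eq_bigr => q' _.
by case: heavy => /=; ring.
Qed.

Lemma rs_trans_ge0 x s x' : 0 <= rs_trans x s x'.
Proof. by apply: push_ge0 => y; exact: rs_move_ge0. Qed.

Lemma rs_trans_sum1 x s : \sum_x' rs_trans x s x' = 1.
Proof. by rewrite push_sum1 rs_move_sum1. Qed.

Let start_ge0 (y : T * state A) : 0 <= #|T|%:R^-1 * init y.2 :> R.
Proof. by rewrite mulr_ge0 ?invr_ge0 ?init_ge0. Qed.

Lemma rs_init_ge0 x : 0 <= rs_init x.
Proof. exact: push_ge0 start_ge0 _. Qed.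

Let sum_start (F : T -> R) :
  \sum_(y : T * state A) #|T|%:R^-1 * init y.2 * F y.1 = \sum_t #|T|%:R^-1 * F t.
Proof.
rewrite -(pair_bigA _ (fun t q => #|T|%:R^-1 * init q * F t)) /=; apply: eq_bigr => t _.
by rewrite -mulr_suml -mulr_sumr init_sum1 mulr1.
Qed.

Lemma rs_init_sum1 : \sum_x rs_init x = 1.
Proof.
rewrite push_sum1 -[RHS](uniform_sum1 R tmax); have /= := sum_start (fun=> 1).
under eq_bigr do rewrite mulr1; under [in RHS]eq_bigr do rewrite mulr1.
by [].
Qed.

Definition restart_pwa : pwa R Sigma :=
  PWA rs_weight rs_init_ge0 rs_init_sum1 rs_trans_ge0 rs_trans_sum1.

Local Notation B := restart_pwa.

(** Restarts distort the law of the simulated state, but its support can be tracked exactly, and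
    this is all that is needed. *)
Lemma rs_law_supp w n (t : T) b (U : {set state A}) q : 0 < law B w n (t, b, U, q) ->
  q \in U /\ forall q', (0 < law A w n q') = (q' \in U).
Proof.
elim: n t b U q => [|n IH] t b U q.
  move=> /(push_gt0P _ start_ge0)[[t' q'] /= q'P [_ _ -> ->]].
  split=> [|q1]; last exact: law0_gt0.
  rewrite finset.in_set lt0r init_ge0 andbT.
  by apply: contraTneq q'P => ->; rewrite mulr0 ltxx.
rewrite lawS => /sum_gt0_ex[[[[t1 b1] U1] q1]] lt_x.
have law1 : 0 < law B w n (t1, b1, U1, q1).
  by rewrite lt0r law_ge0 andbT; apply: contraTneq lt_x => ->; rewrite mul0r ltxx.
have [q1U lawU] := IH _ _ _ _ law1.
have : 0 < rs_trans (t1, b1, U1, q1) (w n) (t, b, U, q).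
  by rewrite lt0r rs_trans_ge0 andbT; apply: contraTneq lt_x => /= ->; rewrite mulr0 ltxx.
move=> /push_gt0P[y|[b' q'] move_gt0 [_ _ -> ->]]; first exact: rs_move_ge0.
have next_post : next_support U1 (w n) = post U1 (w n).
  rewrite /next_support; case: eqP => // post0.
  have [q2 q2P] : exists q2, 0 < trans q1 (w n) q2.
    by apply: sum_gt0_ex; rewrite trans_sum1.
  have : q2 \in post U1 (w n) by apply/postP; exists q1.
  by rewrite post0 finset.in_set0.
rewrite next_post; split; last exact: lawS_gt0.
move: move_gt0; rewrite /= next_post; case: b' => [tq|uq].
  apply/postP; exists q1 => //; rewrite lt0r trans_ge0 andbT.
  by apply: contraTneq tq => ->; rewrite mul0r ltxx.
by apply: contraTT uq => /negbTE nq; rewrite /uniform_on nq mul0r mulr0 ltxx.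
Qed.

(** The level is drawn uniformly and never changes, so each level keeps a fixed mass. *)
Lemma rs_law_level w n t : \sum_x law B w n x * (x.1.1.1 == t)%:R = #|T|%:R^-1.
Proof.
elim: n => [|n IH].
  rewrite push_sum (sum_start (fun t' => (t' == t)%:R)) -mulr_sumr.
  by rewrite sum_indicator mulr1.
rewrite -IH; under eq_bigr do rewrite lawS mulr_suml.
rewrite exchange_big /=; apply: eq_bigr => x _.
under eq_bigr do rewrite -mulrA.
rewrite -mulr_sumr push_sum; congr (_ * _).
by rewrite /= -mulr_suml rs_move_sum1 mul1r.
Qed.

(** On a level below [eta] the bad steps are exactly the restarts, so surviving means simulating [A]
    without restart. *)
Lemma rs_surv w eta i k (t : T) b U q :
  ratr (edge_weight A t) < eta -> eta <= ratr (edge_weight A tmax) ->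
  surv B w (good B w eta) i k (t, b, U, q) =
  surv A w (fun i q q' => heavy t q (w i) q') i k q.
Proof.
move=> t_lt le_tmax; elim: k i b U q => //= k IH i b U q.
under eq_bigr do rewrite -mulrA.
rewrite push_sum sum_bool_pair [X in _ + X]big1 ?addr0; last first.
  by move=> q' _; rewrite /good /= /rs_weight /= leNgt t_lt mul0r mulr0.
by apply: eq_bigr => q' _; rewrite IH /good /= /rs_weight /= le_tmax mul1r.
Qed.

(** [stay_shift] carries the bound to all later times. By averaging, some state then survives with
    probability at least [c / 2], and by pigeonhole one state serves all [k]. *)
Lemma positive_recurrent w eta : positive A w eta -> exists N, exists2 c, 0 < c &
  forall j, (N <= j)%N -> exists2 q, 0 < law A w j q & forall k, c <= surv A w (good A w eta) j k q.
Proof.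
move=> [N [c c0 le_c]]; exists N, (c / 2) => [|j Nj]; first by rewrite divr_gt0.
have {}le_c k : c <= stay A w (good A w eta) j k.
  exact: le_trans (le_c (j - N + k)%N) (stay_shift _ _ _ Nj).
have [||q qP] := @finite_persistent _ (fun q k =>
    0 < law A w j q /\ c / 2 <= surv A w (good A w eta) j k q).
- by move=> q k l kl [? le_l]; split=> //; apply: le_trans le_l _; exact: surv_antitone.
- move=> k; have [q qP] : exists q, 0 < law A w j q * (surv A w (good A w eta) j k q - c / 2).
    apply: sum_gt0_ex; under eq_bigr do rewrite mulrBr.
    rewrite sumrB -mulr_suml law_sum1 mul1r; have := le_c k; rewrite /stay; lra.
  exists q; have lq : 0 < law A w j q.
    by rewrite lt0r law_ge0 andbT; apply: contraTneq qP => ->; rewrite mul0r ltxx.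
  by split=> //; move: qP; rewrite pmulr_rgt0 // subr_gt0 => /ltW.
by exists q; [have [] := qP 0%N|move=> k; have [] := qP k].
Qed.

Lemma rs_almost_sure w eta : almost_sure B w eta <-> positive A w eta.
Proof.
have T0 : (0 : R) < #|T|%:R^-1.
  by rewrite invr_gt0 ltr0n; apply/card_gt0P; exists tmax.
split=> [as_B|pos_A]; last first.
  have [N [c c0 rec]] := positive_recurrent pos_A.
  have Q0 : (0 < #|state A|)%N.
    by have [q0 _] := init_inhabited A; apply/card_gt0P; exists q0.
  have le_tmax : eta <= ratr (edge_weight A tmax).
    have [q _ /(_ 1%N)] := rec N (leqnn N).
    move=> /(lt_le_trans c0) /sum_gt0_ex[q' /= q'P].
    have gq : good A w eta N q q'.
      by apply: contraTT q'P => /negbTE ->; rewrite mulr0 mul0r ltxx.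
    by apply: le_trans gq _; rewrite ler_rat; exact: (tmax_max (q, w N, q')).
  (* A restart hits the recurrent state with probability at least [#|state A|^-1], and that state
     survives with probability at least [c]. *)
  apply: (@stay_recovery _ _ _ _ _ N (c / #|state A|%:R)).
    by rewrite divr_gt0 // ltr0n.
  move=> j [[[t b] U] q] k Nj law_x.
  have [le_t|t_lt] := leP eta (ratr (edge_weight A t)).
    have no_bad x' : (rs_trans (t, b, U, q) (w j) x') *
        (~~ good B w eta j (t, b, U, q) x')%:R = 0.
      have := rs_trans_ge0 (t, b, U, q) (w j) x'; rewrite le_eqVlt => /orP[/eqP <-|].
        by rewrite mul0r.
      move=> /push_gt0P[y|[b' q'] _ ->]; first exact: rs_move_ge0.
      rewrite /good /= /rs_weight /=.
      by case: b'; rewrite ?le_t ?le_tmax /= mulr0.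
    rewrite big1 ?mulr0; last by move=> x' _; exact: no_bad.
    by apply: sumr_ge0 => x' _; rewrite no_bad mul0r.
  have [qU lawU] := rs_law_supp law_x.
  have bad_true q' : good B w eta j (t, b, U, q) (rs_target (t, b, U, q) (w j) (true, q')).
    by rewrite /good /= /rs_weight.
  have bad_false q' : ~~ good B w eta j (t, b, U, q) (rs_target (t, b, U, q) (w j) (false, q')).
    by rewrite /good /= /rs_weight /= -ltNge.
  under [leRHS]eq_bigr do rewrite -mulrA.
  rewrite !push_sum !sum_bool_pair.
  rewrite big1 ?add0r => [|q' _]; last by rewrite bad_true mulr0.
  rewrite [X in _ <= X + _]big1 ?add0r => [|q' _]; last by rewrite bad_true mul0r mulr0.
  under eq_bigr do rewrite bad_false mulr1.
  under [leRHS]eq_bigr do rewrite bad_false mul1r /rs_target /= rs_surv //.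
  rewrite /= -mulr_sumr uniform_on_sum1 ?next_support_neq0 // mulr1.
  under eq_bigr do rewrite -mulrA.
  rewrite -mulr_sumr mulrC ler_wpM2l ?failure_ge0 //.
  have [q1 law_q1 surv_q1] := rec j.+1 (leqW Nj).
  have q1_next : q1 \in next_support U (w j).
    have /postP q1U : q1 \in post U (w j) by rewrite -(lawS_gt0 lawU).
    rewrite /next_support; case: ifP => [_|_]; first by rewrite finset.in_setT.
    exact/postP.
  rewrite (bigD1 q1) //=; apply: ler_wpDr.
    by apply: sumr_ge0 => q2 _; rewrite mulr_ge0 ?uniform_on_ge0 ?surv_ge0.
  have -> : uniform_on (next_support U (w j)) q1 = #|next_support U (w j)|%:R^-1.
    by rewrite /uniform_on q1_next mul1r.
  rewrite mulrC; apply: ler_pM; rewrite ?invr_ge0 ?ler0n ?(ltW c0) //.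
    by rewrite lef_pV2 ?posrE ?ltr0n ?card_next_support // ler_nat max_card.
  apply: le_trans (surv_q1 k) _; apply: surv_le => i q2 q3 _ g23.
  rewrite /heavy -(ltr_rat R); exact: lt_le_trans t_lt g23.
have [low|] := pselect (forall t, eta <= ratr (edge_weight A t)).
  exists 0%N, 1 => // k; rewrite stay_all // => i q q'; exact: low (q, w i, q').
move=> /existsNP[t1 /negP]; rewrite -ltNge => t1_lt.
(* For the greatest level below [eta], exceeding its weight means reaching [eta]. *)
have [t t_lt t_next] : exists2 t : T, ratr (edge_weight A t) < eta &
    forall t', edge_weight A t < edge_weight A t' -> eta <= ratr (edge_weight A t').
  case: (@Order.TotalTheory.arg_maxP _ _ _ t1 [pred t : T | ratr (edge_weight A t) < eta]
    (edge_weight A) t1_lt) => t /= t_lt t_max.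
  exists t => // t' tt'; rewrite leNgt; apply: contraTN tt' => /t_max; by rewrite leNgt.
(* Half the mass of a level: losing at most [e] leaves mass at least [e] surviving on level [t], so
   some state there survives with probability at least [e / 2]. *)
pose e : R := #|T|%:R^-1 / 2.
have e0 : 0 < e by rewrite divr_gt0.
have [n le_n] := as_B e e0.
have [||x xP] := @finite_persistent _ (fun x k =>
    [/\ 0 < law B w n x, x.1.1.1 = t & e / 2 <= surv B w (good B w eta) n k x]).
- by move=> x k l kl [? ? le_l]; split=> //; apply: le_trans le_l _; exact: surv_antitone.
- move=> k.
  have [x xP] : exists x, 0 < law B w n x *
      ((x.1.1.1 == t)%:R * surv B w (good B w eta) n k x - e / 2).
    apply: sum_gt0_ex; under eq_bigr do rewrite mulrBr.
    rewrite sumrB -mulr_suml law_sum1 mul1r subr_gt0.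
    apply: (@lt_le_trans _ _ (#|T|%:R^-1 - e)); first by rewrite /e in e0 *; lra.
    rewrite lerBlDr -(rs_law_level w n t).
    apply: (@le_trans _ _ (\sum_x law B w n x * ((x.1.1.1 == t)%:R *
      surv B w (good B w eta) n k x + (1 - surv B w (good B w eta) n k x)))).
      apply: ler_sum => x _; rewrite ler_wpM2l ?law_ge0 //.
      have := surv_le1 w (good B w eta) n k x.
      by case: (_ == t) => /=; lra.
    under eq_bigr do rewrite mulrDr mulrBr mulr1.
    rewrite big_split /= lerD2l sumrB [X in X - _](law_sum1 B w n).
    by rewrite lerBlDr -lerBlDl; exact: le_n.
  exists x; have lx : 0 < law B w n x.
    by rewrite lt0r law_ge0 andbT; apply: contraTneq xP => ->; rewrite mul0r ltxx.
  move: xP; rewrite pmulr_rgt0 // subr_gt0; case: eqP => [xt|_] /=.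
    by rewrite mul1r => /ltW.
  by rewrite mul0r => h; move: e0 h; lra.
have [law_x xt _] := xP 0%N; case: x law_x xt xP => -[[t' b] U] q law_x /= -> xP.
have [qU lawU] := rs_law_supp law_x.
have e20 : 0 < e / 2 by rewrite divr_gt0.
have le_tmax : eta <= ratr (edge_weight A tmax).
  have [_ _ /(lt_le_trans e20) /sum_gt0_ex[x' /= x'P]] := xP 1%N.
  have : good B w eta n (t, b, U, q) x'.
    by apply: contraTT x'P => /negbTE ->; rewrite mulr0 mul0r ltxx.
  rewrite /good /= /rs_weight; case: ifP => // _ /le_trans; apply.
  by rewrite ler_rat.
exists n, (law A w n q * (e / 2)) => [|k]; first by rewrite mulr_gt0 ?lawU.
rewrite /stay (bigD1 q) //=; apply: ler_wpDr.
  by apply: sumr_ge0 => q' _; rewrite mulr_ge0 ?law_ge0 ?surv_ge0.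
rewrite ler_wpM2l ?law_ge0 //; have [_ _] := xP k; rewrite rs_surv // => /le_trans; apply.
by apply: surv_le => i q1 q2 _ hv; exact: t_next (q1, w i, q2) hv.
Qed.

End Restart.

Lemma PosLimInf_reducible_AsLimInf (R : realType) : reducible (@PosLimInf R) (@AsLimInf R).
Proof.
move=> Sigma A; have [q0 _] := init_inhabited A.
have [s0|no_s] := pickP (@predT Sigma); last first.
  by exists A => w; have := no_s (w 0%N).
move=> _; have [tmax tmax_max] := max_edge_ex q0 s0.
exists (restart_pwa tmax) => w; rewrite /PosLimInf /AsLimInf LPosE LAsE.
by apply: level_sup_ext => eta; rewrite rs_almost_sure.
Qed.

(** * Positive semantics is not nondeterministic *)

Lemma expr_lt (R : realType) (c e : R) : 0 <= c < 1 -> 0 < e -> exists j, c ^+ j < e.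
Proof.
move=> /andP[c0 c1] e0; have /cvgrPdist_lt/(_ e e0)[N _ /(_ N (leqnn N))] : GRing.exp c @ \oo --> 0.
  by apply: cvg_expr; rewrite ger0_norm.
by rewrite sub0r normrN ger0_norm ?exprn_ge0 // => ?; exists N.
Qed.

Lemma sum_option_bool (R : nmodType) (F : option bool -> R) :
  \sum_q F q = F None + F (Some false) + F (Some true).
Proof.
rewrite (bigD1 None) // (bigD1 (Some false)) // (bigD1 (Some true)) //=.
by rewrite big1 ?addr0 ?addrA //; case=> [[]|].
Qed.

(* The letter [false] is a and [true] is b. Within a block a^k b the automaton
   reaches [Some true] with probability 1 - 2^-k, and from [Some false] the
   letter b leads to the sink [None]. *)
Section BlockAutomaton.
Context {R : realType}.

Definition block_trans (q : option bool) (s : bool) (q' : option bool) : R :=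
  match q, s with
  | Some false, false => if q' is Some _ then 2^-1 else 0
  | Some true, false => (q' == Some true)%:R
  | Some true, true => (q' == Some false)%:R
  | _, _ => (q' == None)%:R
  end.

Definition block_weight (q : option bool) (s : bool) (q' : option bool) : rat :=
  if q' is Some _ then 1 else 0.

Definition block_init (q : option bool) : R := (q == Some false)%:R.

Lemma block_trans_ge0 q s q' : 0 <= block_trans q s q'.
Proof. by case: q => [[]|]; case: s => //=; case: q' => //= _; rewrite invr_ge0. Qed.

Lemma block_trans_sum1 q s : \sum_q' block_trans q s q' = 1.
Proof. by rewrite sum_option_bool; case: q => [[]|]; case: s => /=; lra. Qed.

Lemma block_init_ge0 q : 0 <= block_init q. Proof. exact: ler0n. Qed.
Lemma block_init_sum1 : \sum_q block_init q = 1. Proof. exact: sum_indicator. Qed.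

Definition block_pwa : pwa R bool :=
  PWA block_weight block_init_ge0 block_init_sum1 block_trans_ge0 block_trans_sum1.

Let alive (i : nat) (q q' : option bool) : bool := q'.

Lemma block_good w eta : 0 < eta <= 1 -> good block_pwa w eta = alive.
Proof.
move=> /andP[eta0 eta1]; apply/funext => i; apply/funext => q; apply/funext => -[q'|].
  by rewrite /good /= rmorph1 eta1.
by rewrite /good /= rmorph0 leNgt eta0.
Qed.

Let s w i k q := surv block_pwa w alive i k q.

Let survS w i k :
  [/\ s w i k.+1 (Some false) =
        if w i then 0 else (s w i.+1 k (Some false) + s w i.+1 k (Some true)) / 2,
      s w i k.+1 (Some true) = s w i.+1 k (Some (~~ w i)) &
      s w i k.+1 None = 0].
Proof. by rewrite /s /= !sum_option_bool /=; case: (w i) => /=; split; lra. Qed.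

(* The word a^2 b a^3 b a^4 b ...; the configuration holds the length of the
   current block and the number of letters a left in it. *)
Definition block_step (x : nat * nat) : nat * nat :=
  if x.2 is j.+1 then (x.1, j) else (x.1.+1, x.1.+1).

Definition block_config t := iter t block_step (2%N, 2%N).

Definition block_word (t : nat) : bool := (block_config t).2 == 0%N.

(** In a block of length [i], the later blocks lose at most [2 ^- i.+1 + 2 ^- i.+2 + ... = 2 ^- i].
    From [Some false], the current block loses a further [2 ^- j], with [j] letters a left. *)
Let block_word_surv t k :
  1 - 2 ^- (block_config t).1 <= s block_word t k (Some true) /\
  1 - 2 ^- (block_config t).2 - 2 ^- (block_config t).1 <= s block_word t k (Some false).
Proof.
elim: k t => [|k IH] t.
  have p2 n : (0 : R) <= 2 ^- n by rewrite invr_ge0 exprn_ge0.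
  by have := p2 (block_config t).1; have := p2 (block_config t).2; rewrite /s /=; lra.
have [-> -> _] := survS block_word t k; have := IH t.+1.
rewrite /block_word /= -/(block_config t); case: (block_config t) => i [|j] /=.
  have : (0 : R) <= 2 ^- i by rewrite invr_ge0 exprn_ge0.
  by rewrite !exprS !invfM expr0; lra.
by rewrite exprS invfM => -[? ?]; split; lra.
Qed.

Lemma block_word_positive : positive block_pwa block_word 1.
Proof.
(* The initial configuration gives [1 - 2 ^- 2 - 2 ^- 2]. *)
exists 0%N, (2^-1) => // k; rewrite block_good ?ltr01 ?lexx //.
rewrite /stay sum_option_bool /= /block_init /= !mul0r add0r addr0 mul1r.
by have [_] := block_word_surv 0 k; rewrite /s /=; lra.
Qed.

Lemma block_word_inf n : exists2 m, (n <= m)%N & block_word m.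
Proof.
have H j : forall t, (block_config t).2 = j -> block_word (t + j).
  elim: j => [|j IH] t tj; first by rewrite addn0 /block_word tj.
  rewrite -addSnnS; apply: IH; rewrite /= -/(block_config t).
  by move: tj; case: (block_config t) => i j' /= ->.
by exists (n + (block_config n).2)%N; [exact: leq_addr|exact: H].
Qed.

(** Blocks of length below [L] each keep at most the fraction [1 - 2 ^- L], so survival decays
    geometrically. *)
Lemma bounded_gaps_not_positive (w : nat -> bool) i0 L :
  (forall t, (i0 <= t)%N -> exists2 d, (d < L)%N & w (t + d)%N) ->
  forall eta, 0 < eta <= 1 -> ~ positive block_pwa w eta.
Proof.
move=> gaps eta eta01 /positive_recurrent[N [c c0]]; rewrite block_good // => rec.
have block d t k : (forall e, (e < d)%N -> ~~ w (t + e)%N) -> w (t + d)%N ->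
    s w t (d.+1 + k) (Some false) = (1 - 2 ^- d) * s w (t + d).+1 k (Some false) /\
    s w t (d.+1 + k) (Some true) = s w (t + d).+1 k (Some false).
  elim: d t k => [|d IH] t k.
    rewrite addn0 => _ wt; have [-> -> _] := survS w t k.
    by rewrite wt expr0 invr1 subrr mul0r.
  move=> no_b wtd; have := no_b 0%N isT; rewrite addn0 => /negbTE wt.
  have [||E0 E1] := IH t.+1 k; first by move=> e ed; rewrite addSnnS; exact: no_b.
    by rewrite addSnnS.
  rewrite (addSnnS t d) in E0 E1; have [-> -> _] := survS w t (d.+1 + k).
  rewrite wt /= E0 E1.
  by split=> //; rewrite exprS invfM; field.
pose b : R := 1 - 2 ^- L.
have b01 : 0 <= b < 1.
  rewrite /b subr_ge0 ltrBlDr ltrDl invr_gt0 exprn_gt0 // andbT.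
  by rewrite invf_le1 ?exprn_gt0 // exprn_ege1 // ler1n.
have next_b t : (i0 <= t)%N -> exists d, [/\ (d < L)%N, w (t + d)%N &
    forall e, (e < d)%N -> ~~ w (t + e)%N].
  move=> /gaps[d0 d0L wd0]; have ex_d : exists d, w (t + d)%N by exists d0.
  case: (ex_minnP ex_d) => d wd min_d; exists d; split=> //.
    exact: leq_ltn_trans (min_d _ wd0) d0L.
  by move=> e; apply: contraTN => /min_d; rewrite leqNgt.
have decay j t k : (i0 <= t)%N -> (j * L <= k)%N -> s w t k (Some false) <= b ^+ j.
  elim: j t k => [|j IH] t k it jk; first by rewrite expr0 surv_le1.
  have [d [dL wd no_b]] := next_b t it.
  have -> : k = (d.+1 + (k - d.+1))%N by lia.
  have [-> _] := block d t (k - d.+1)%N no_b wd.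
  rewrite exprS; apply: ler_pM; rewrite ?surv_ge0 //.
  - by rewrite subr_ge0 invf_le1 ?exprn_gt0 // exprn_ege1 // ler1n.
  - by rewrite lerB // lef_pV2 ?posrE ?exprn_gt0 // ler_weXn2l ?ler1n // ltnW.
  - by apply: IH; lia.
have [j bj] := expr_lt b01 c0.
pose t := maxn N i0.
(* From [Some true], the current block is completed first and leads to [Some false]. *)
have [[[]|] _ surv_c] := rec t (leq_maxl _ _).
- have [d [dL wd no_b]] := next_b t (leq_maxr _ _).
  have it : (i0 <= (t + d).+1)%N by have := leq_maxr N i0; rewrite /t; lia.
  have := surv_c (d.+1 + j * L)%N; have [_] := block d t (j * L)%N no_b wd; rewrite /s => ->.
  by have := decay j _ _ it (leqnn (j * L)%N); rewrite /s; lra.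
- have := surv_c (j * L)%N; have := decay j t (j * L)%N (leq_maxr _ _) (leqnn _); rewrite /s; lra.
- by have := surv_c 1%N; have [_ _] := survS w t 0; rewrite /s => ->; lra.
Qed.

End BlockAutomaton.

(** A state recurs along an accepting run; a loop on it, taken after [n] and reading [b], is
    repeated forever. *)
Lemma pump_run (R : realType) (Sigma : finType) (A : pwa R Sigma) w eta
    (b : Sigma) : possible A w eta -> (forall n, exists2 m, (n <= m)%N & w m = b) ->
  exists w' : nat -> Sigma, possible A w' eta /\
    exists i0 L, forall t, (i0 <= t)%N -> exists2 d, (d < L)%N & w' (t + d)%N = b.
Proof.
move=> /possibleP[r [[init_r run_r] /LimInf_geP[n gn]]] inf_b.
have [||q visits] := @finite_persistent _ (fun q m => exists2 i, (m <= i)%N & r i = q).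
- by move=> q k l kl [i li ri]; exists i => //; exact: leq_trans li.
- by move=> m; exists (r m), m.
have [i ni ri] := visits n; have [k ik wk] := inf_b i; have [j kj rj] := visits k.+1.
pose p := (j - i)%N; have p0 : (0 < p)%N by rewrite /p; lia.
pose fold t := if (t < i)%N then t else (i + (t - i) %% p)%N.
have fold_ge t : (n <= t)%N -> (n <= fold t)%N.
  by rewrite /fold; case: ifP => // _ _; exact: leq_trans (leq_addr _ _).
have foldS t : r (fold t.+1) = r (fold t).+1.
  rewrite /fold; have [ti|it] := ltnP t i.
    by case: ltnP => // it; rewrite (_ : t.+1 = i) ?subnn ?mod0n ?addn0 //; lia.
  rewrite ltnNge (leqW it) /= subSn // modnS; case: ifP => [dvd_p|_]; last by rewrite addnS.
  rewrite addn0 ri -rj; congr r; have := ltn_pmod (t - i) p0.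
  have := divn_eq (t - i) p; case/dvdnP: dvd_p => m.
  move: ((t - i) %/ p)%N ((t - i) %% p)%N => u v tS tE vp.
  have mu : m = u.+1 by nia.
  by move: tS tE; rewrite mu /p; lia.
exists (w \o fold); split.
  apply/possibleP; exists (r \o fold); split; first split.
  - by rewrite /= /fold; case: ifP => // i0; rewrite (_ : i = 0%N) ?sub0n ?mod0n //; lia.
  - by move=> t; rewrite /= foldS.
  - by apply/LimInf_geP; exists n => t nt; rewrite /good /= foldS; apply/gn/fold_ge.
exists i, (p + p)%N => t it.
(* The copy of [k] in the iteration of the loop after the one containing [t], hence less than
   [2 * p] steps ahead. *)
pose u := (((t - i) %/ p).+1 * p + (k - i))%N.
have tu : (t <= i + u < t + (p + p))%N.
  rewrite /u mulSn; have := divn_eq (t - i) p; have := ltn_pmod (t - i) p0.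
  have : (k - i < p)%N by rewrite /p; lia.
  lia.
exists (i + u - t)%N; first lia.
rewrite /= subnKC; last by case/andP: tu.
rewrite /fold ltnNge leq_addr /= addKn /u modnMDl modn_small ?subnKC //.
by rewrite /p; lia.
Qed.

Lemma PosLimInf_not_reducible_NLimInf (R : realType) : ~ reducible (@PosLimInf R) (@NLimInf R).
Proof.
move=> /(_ _ block_pwa)[B AB].
have [||w [pos_w [i0 [L gaps]]]] := @pump_run R bool B block_word 2^-1 true.
- apply: level_sup_gt; first exact: possible_le.
  rewrite -LMaxE -[LMax _ _]/(NLimInf _ _) -AB /PosLimInf LPosE.
  apply: lt_le_trans (level_sup_ge block_word_positive).
  by rewrite lte_fin; lra.
- by move=> n; have [m nm wm] := block_word_inf n; exists m.
apply: (@bounded_gaps_not_positive R w i0 L gaps 4^-1); first lra.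
apply: level_sup_gt; first exact: positive_le.
rewrite -LPosE -[LPos _ _]/(PosLimInf _ _) AB /NLimInf LMaxE.
by apply: lt_le_trans (level_sup_ge pos_w); rewrite lte_fin; lra.
Qed.

(** * Almost-sure semantics is not positive *)

(* Almost surely the state [Some true] is reached; it is left, for the accepting
   sink [None], at the next letter b. *)
Section InfinitelyOften.
Context {R : realType}.

Definition io_trans (q : option bool) (s : bool) (q' : option bool) : R :=
  match q with
  | Some false => if q' is Some _ then 2^-1 else 0
  | Some true => (q' == if s then None else Some true)%:R
  | None => (q' == None)%:R
  end.

Definition io_weight (q : option bool) (s : bool) (q' : option bool) : rat :=
  (q' != Some true)%:R.

Definition io_init (q : option bool) : R := (q == Some false)%:R.

Lemma io_trans_ge0 q s q' : 0 <= io_trans q s q'.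
Proof. by case: q => [[]|] //=; case: q' => //= _; rewrite invr_ge0. Qed.

Lemma io_trans_sum1 q s : \sum_q' io_trans q s q' = 1.
Proof. by rewrite sum_option_bool; case: q => [[]|]; case: s => /=; lra. Qed.

Lemma io_init_ge0 q : 0 <= io_init q. Proof. exact: ler0n. Qed.
Lemma io_init_sum1 : \sum_q io_init q = 1. Proof. exact: sum_indicator. Qed.

Definition io_pwa : pwa R bool :=
  PWA io_weight io_init_ge0 io_init_sum1 io_trans_ge0 io_trans_sum1.

Let ok (i : nat) (q q' : option bool) : bool := q' != Some true.

Lemma io_good w eta : 0 < eta <= 1 -> good io_pwa w eta = ok.
Proof.
move=> /andP[eta0 eta1]; apply/funext => i; apply/funext => q; apply/funext => q'.
rewrite /good /= /io_weight /ok ratr_nat; case: (q' != Some true) => //.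
by rewrite leNgt eta0.
Qed.

Let law_io w n : [/\ law io_pwa w n (Some false) = 2 ^- n,
  law io_pwa w n.+1 (Some true) =
    2 ^- n.+1 + (if w n then 0 else law io_pwa w n (Some true)) &
  law io_pwa w n None = 1 - 2 ^- n - law io_pwa w n (Some true)].
Proof.
have law_false : law io_pwa w n (Some false) = 2 ^- n.
  elim: n => [|n IH]; first by rewrite /= /io_init eqxx expr0 invr1.
  by rewrite lawS sum_option_bool IH /= exprS invfM; case: (w n) => /=; ring.
split=> //.
  by rewrite lawS sum_option_bool law_false /= exprS invfM; case: (w n) => /=; ring.
by have := law_sum1 io_pwa w n; rewrite sum_option_bool law_false; lra.
Qed.

(** Right after a letter b at time [n], the mass of [Some true] has just been accepted and only
    [2 ^- n] lies outside the sink. *)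
Lemma io_almost_sure (w : nat -> bool) :
  (forall n, exists2 m, (n <= m)%N & w m) -> almost_sure io_pwa w 1.
Proof.
move=> inf_b e e0; have [n0 n0e] : exists n, (2^-1 : R) ^+ n < e.
  by apply: expr_lt => //; lra.
have [n n0n wn] := inf_b n0; exists n.+1 => k.
rewrite io_good ?ltr01 ?lexx // /stay sum_option_bool -addrA; apply: ler_wpDr.
  by rewrite addr_ge0 // mulr_ge0 ?law_ge0 ?surv_ge0.
have -> : surv io_pwa w ok n.+1 k None = 1.
  elim: k n.+1 => // k IH i /=.
  by rewrite sum_option_bool /= IH; ring.
have [_ _ ->] := law_io w n.+1; have [_ -> _] := law_io w n; rewrite wn mulr1 addr0.
have : (2^-1 : R) ^+ n <= 2^-1 ^+ n0 by rewrite ler_wiXn2l //; lra.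
by rewrite exprS invfM -exprVn; lra.
Qed.

(** The mass [2 ^- N.+1] entering [Some true] at time [N.+1] is stuck there, and each of its steps
    is bad. *)
Lemma io_not_almost_sure (w : nat -> bool) N : (forall n, (N <= n)%N -> ~~ w n) ->
  forall eta, 0 < eta <= 1 -> ~ almost_sure io_pwa w eta.
Proof.
move=> fin_b eta eta01; rewrite /almost_sure io_good // => as_w.
pose d : R := 2 ^- N.+1; have d0 : 0 < d by rewrite invr_gt0 exprn_gt0.
have stuck t : (N < t)%N -> d <= law io_pwa w t (Some true).
  elim: t => // t IH; rewrite ltnS => Nt; have [_ -> _] := law_io w t.
  have p0 : (0 : R) < 2 ^- t.+1 by rewrite invr_gt0 exprn_gt0.
  rewrite (negbTE (fin_b t Nt)); move: Nt; rewrite leq_eqVlt => /orP[/eqP <-|/IH]; last lra.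
  by rewrite lerDl law_ge0.
have [n le_n] := as_w (d / 2) (divr_gt0 d0 (ltr0Sn _ 1)).
pose t := maxn n N.+1.
have := le_trans (le_n (t - n + 1)%N) (@stay_shift _ _ io_pwa w ok _ _ 1 (leq_maxl n N.+1)).
have := stuck t (leq_maxr _ _); have := law_sum1 io_pwa w t.
rewrite /stay !sum_option_bool.
have -> : surv io_pwa w ok t 1 (Some true) = 0.
  rewrite /= sum_option_bool /= (negbTE (fin_b t _)) /=; first by ring.
  exact: leq_trans (leqnSn N) (leq_maxr _ _).
have l1 q : law io_pwa w t q * surv io_pwa w ok t 1 q <= law io_pwa w t q.
  by rewrite ler_piMr ?law_ge0 ?surv_le1.
have := l1 None; have := l1 (Some false); rewrite mulr0; lra.
Qed.

End InfinitelyOften.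

(** Dependence on finitely many letters makes a lower bound on [stay] for all [k] a closed condition
    on words. *)
Lemma stay_local (R : realType) (Sigma : finType) (B : pwa R Sigma) (w w' : nat -> Sigma) eta n k :
  (forall i, (i < n + k)%N -> w i = w' i) ->
  stay B w (good B w eta) n k = stay B w' (good B w' eta) n k.
Proof.
move=> ww'; apply: eq_bigr => q _; congr (_ * _).
  have {}ww' i : (i < n)%N -> w i = w' i by move=> ?; apply: ww'; lia.
  elim: n q ww' => // n IH q ww'; rewrite !lawS; apply: eq_bigr => q' _.
  by rewrite IH ?ww' // => i ?; apply: ww'; exact: leqW.
elim: k n q ww' => // k IH n q ww' /=; apply: eq_bigr => q' _.
by rewrite /good ww' ?IH // => [i|]; [rewrite addSnnS; exact: ww'|lia].
Qed.

(* The words with positive value form a countable union of closed sets, but the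
   set of words with infinitely many b is a dense G_delta with dense complement:
   a word with infinitely many b avoiding all the closed sets is built by
   inserting the letters b one by one, far enough apart. *)
Lemma inf_often_not_positive (R : realType) (B : pwa R bool) (eta : R) :
  (forall (w : nat -> bool) N, (forall n, (N <= n)%N -> ~~ w n) -> ~ positive B w eta) ->
  exists2 w : nat -> bool, (forall n, exists2 m, (n <= m)%N & w m) & ~ positive B w eta.
Proof.
move=> fin_b; pose word (us : seq nat) (t : nat) := t \in us.
pose st w n k := stay B w (good B w eta) n k.
(* The next b goes beyond the horizon at which the word built so far already has small [stay]. *)
have /choice[next nextP] (us : seq nat) : exists m,
    [/\ (forall u, u \in us -> (u < m)%N), (size us <= m)%N &
      exists2 k, (size us + k <= m)%N & st (word us) (size us) k < 2^-1 ^+ size us].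
  have [k small] : exists k, st (word us) (size us) k < 2^-1 ^+ size us.
    apply: contrapT => /forallNP big; apply: (fin_b (word us) (\max_(u <- us) u).+1).
      move=> n lt_n; apply/negP => n_us.
      by have := @leq_bigmax_seq _ us xpredT id n n_us isT; rewrite leqNgt lt_n.
    exists (size us), (2^-1 ^+ size us); first by rewrite exprn_gt0 // invr_gt0.
    by move=> k; rewrite leNgt; apply/negP/big.
  exists ((\max_(u <- us) u).+1 + (size us + k))%N; split; last by exists k; rewrite ?leq_addl.
    by move=> u uus; have /= := @leq_bigmax_seq _ us xpredT id u uus isT; lia.
  lia.
pose us := fix us j := if j is i.+1 then next (us i) :: us i else [::].
have size_us j : size (us j) = j by elim: j => //= j ->.
have us_sub i j : (i <= j)%N -> {subset us i <= us j}.
  move=> /subnKC <-; elim: (j - i)%N => [|d IH] t ti; first by rewrite addn0.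
  by rewrite addnS inE IH ?orbT.
have us_new i j t : (i <= j)%N -> t \in us j -> (t < next (us i))%N -> t \in us i.
  move=> /subnKC <-; elim: (j - i)%N => [|d IH]; rewrite ?addn0 // addnS inE.
  case/orP=> [/eqP -> |]; last exact: IH.
  rewrite ltnNge; have [->|d0] := eqVneq d 0%N; first by rewrite addn0 leqnn.
  have [lt_next _ _] := nextP (us (i + d)%N).
  rewrite ltnW // lt_next //; apply: (us_sub i.+1); last exact: mem_head.
  by rewrite -addn1 leq_add2l lt0n.
pose w t := `[< exists j, t \in us j >].
exists w => [n|[N [c c0 le_c]]].
  exists (next (us n)); first by have [_] := nextP (us n); rewrite size_us.
  by apply/asboolP; exists n.+1; exact: mem_head.
have [j0 j0c] : exists j, (2^-1 : R) ^+ j < c by apply: expr_lt => //; lra.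
(* Letters inserted after stage [j] lie beyond the first [j + k], so the small value of [stay]
   persists for [w]. *)
pose j := maxn N j0; have [_ _ [k]] := nextP (us j); rewrite size_us => jk.
rewrite ltNge => /negP; apply.
have -> : st (word (us j)) j k = st w j k.
  apply: stay_local => i ijk; apply/idP/asboolP => [ij|[j' ij']]; first by exists j.
  have [jj'|/ltnW j'j] := leqP j j'; last exact: us_sub ij'.
  by apply: us_new jj' ij' _; exact: leq_trans jk.
apply: le_trans (stay_shift _ _ _ (leq_maxl N j0)); apply: le_trans (le_c _).
apply: le_trans (ltW j0c); rewrite ler_wiXn2l ?leq_maxr //; lra.
Qed.

Lemma AsLimInf_not_reducible_PosLimInf (R : realType) : ~ reducible (@AsLimInf R) (@PosLimInf R).
Proof.
move=> /(_ _ io_pwa)[B AB].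
have [w N fin_b pos_w|w inf_b] := @inf_often_not_positive R B 2^-1.
  apply: (@io_not_almost_sure R w N fin_b 4^-1); first lra.
  apply: level_sup_gt; first exact: almost_sure_le.
  rewrite -LAsE -[LAs _ _]/(AsLimInf _ _) AB /PosLimInf LPosE.
  by apply: lt_le_trans (level_sup_ge pos_w); rewrite lte_fin; lra.
apply; apply: level_sup_gt; first exact: positive_le.
rewrite -LPosE -[LPos _ _]/(PosLimInf _ _) -AB /AsLimInf LAsE.
apply: lt_le_trans (level_sup_ge (io_almost_sure inf_b)).
by rewrite lte_fin; lra.
Qed.

Theorem theorem3 (R : realType) :
  reducible (@NLimInf R) (@PosLimInf R) /\
  reducible (@PosLimInf R) (@AsLimInf R) /\
  ~ reducible (@PosLimInf R) (@NLimInf R) /\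
  ~ reducible (@AsLimInf R) (@PosLimInf R).
Proof.
split; first exact: NLimInf_reducible_PosLimInf.
split; first exact: PosLimInf_reducible_AsLimInf.
split; first exact: PosLimInf_not_reducible_NLimInf.
exact: AsLimInf_not_reducible_PosLimInf.
Qed.
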